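(* Let $\Pi\subseteq\mathfrak{S}_3$ be a set of permutations of length $3$ such that $\{123,321\}\not\subseteq\Pi$. Then the following are equivalent: (1) $Q_n(\Pi)$ is symmetric for all $n$. (2) $Q_n(\Pi)$ is Schur nonnegative for all $n$. (3) $\Pi$ is one of the following sets: $\emptyset$; $\{123\}$; $\{321\}$; $\{132,213\}$; $\{132,312\}$; $\{213,231\}$; $\{231,312\}$; $\{123,132,312\}$; $\{123,213,231\}$; $\{123,231,312\}$; $\{132,213,321\}$; $\{132,312,321\}$; $\{213,231,321\}$; $\{132,213,231,312\}$; $\{123,132,213,231,312\}$; $\{132,213,231,312,321\}$.
   Context: $\mathfrak{S}_n$ is the set of permutations $\pi=\pi_1\cdots\pi_n$ of $[n]=\{1,\dots,n\}$ in one-line notation. A permutation $\sigma$ contains a permutation $\pi$ as a pattern if some (not necessarily consecutive) subsequence of $\sigma$ is order-isomorphic to $\pi$; otherwise $\sigma$ avoids $\pi$. $\mathfrak{S}_n(\Pi)$ is the set of $\sigma\in\mathfrak{S}_n$ avoiding every $\pi\in\Pi$. The descent set of $\sigma$ is $\mathrm{Des}\,\sigma=\{i\mid\sigma_i>\sigma_{i+1}\}\subseteq[n-1]$. For $S\subseteq[n-1]$ the fundamental quasisymmetric function (of degree $n$, in variables $x_1,x_2,\dots$) is $F_S=\sum x_{i_1}x_{i_2}\cdots x_{i_n}$, summed over all $i_1\le i_2\le\dots\le i_n$ with $i_s<i_{s+1}$ whenever $s\in S$. Define $Q_n(\Pi)=\sum_{\sigma\in\mathfrak{S}_n(\Pi)}F_{\mathrm{Des}\,\sigma}$.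 A power series of bounded degree is symmetric if it is invariant under all permutations of the variables. Schur nonnegative means: symmetric, with all coefficients nonnegative in the expansion in the Schur basis $s_\lambda$. *)

(* Defs.v *)
From mathcomp Require Import all_boot all_order all_fingroup all_algebra.
From mathcomp Require Import finmap multiset.

Set Implicit Arguments.
Unset Strict Implicit.
Unset Printing Implicit Defensive.

Local Open Scope mset_scope.
Local Open Scope nat_scope.

Definition oneline n (sigma : 'S_n) : seq nat :=
  [seq (sigma i).+1 | i <- enum 'I_n].

Definition contains n k (sigma : 'S_n) (pi : 'S_k) : bool :=
  [exists f : {ffun 'I_k -> 'I_n},
     [forall i : 'I_k, forall j : 'I_k, (i < j) ==> (f i < f j)] &&
     [forall i : 'I_k, forall j : 'I_k, (sigma (f i) < sigma (f j)) == (pi i < pi j)]].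

Definition avoids n k (Pi : {set 'S_k}) (sigma : 'S_n) : bool :=
  [forall pi in Pi, ~~ contains sigma pi].

(* The position s.+1 in [n-1] is represented by s : 'I_n.-1. *)
Definition Des n (sigma : 'S_n) : {set 'I_n.-1} :=
  [set s : 'I_n.-1 | nth 0 (oneline sigma) s > nth 0 (oneline sigma) s.+1].

(** Formal power series with integer coefficients in the variables x_i,
    i : nat (the variable x_1 of the literature is the one of index 0).
    A monomial is the multiset of the indices of its variables, so that its
    exponent at x_i is m i; a series is its function of coefficients. *)

Definition series := {mset nat} -> int.

(* The sum of x_{w_1} x_{w_2} ... over all words w satisfying P.  The words
   whose monomial is m are exactly the members of permutations m, which is
   free of duplicates. *)
Definition word_series (P : pred (seq nat)) : series :=
  fun m => Posz (count P (permutations m)).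

Definition rename (g : nat -> nat) (m : {mset nat}) : {mset nat} :=
  seq_mset [seq g i | i <- m].

Definition symmetric_series (f : series) : Prop :=
  forall g : nat -> nat, bijective g -> forall m, f (rename g m) = f m.

Definition fundamental n (S : {set 'I_n.-1}) : series :=
  word_series (fun w =>
    [&& size w == n, sorted leq w & [forall s in S, nth 0 w s < nth 0 w s.+1]]).

Definition Q n k (Pi : {set 'S_k}) : series :=
  fun m => (\sum_(sigma : 'S_n | avoids Pi sigma) fundamental (Des sigma) m)%R.

(* w is the row by row reading word (top row first) of a semistandard tableau
   of shape la: rows weakly increase, and columns strictly increase downwards.
   As la is weakly decreasing, zip truncates an upper row to the length of the
   row below it. *)
Definition semistandard (la w : seq nat) : bool :=
  [&& size w == sumn la,
      all (sorted leq) (reshape la w) &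
      sorted (fun r r' => all (fun p => p.1 < p.2) (zip r r')) (reshape la w)].

Definition schur (la : seq nat) : series := word_series (semistandard la).

(* Partitions of n are padded with zeros to exactly n parts. *)
Definition parts n (la : n.-tuple 'I_n.+1) : seq nat :=
  [seq nat_of_ord i | i <- la].

Definition is_partition n (la : n.-tuple 'I_n.+1) : bool :=
  sorted geq (parts la) && (sumn (parts la) == n).

(* Schur nonnegativity of a series that is homogeneous of degree n. *)
Definition schur_nonneg n (f : series) : Prop :=
  symmetric_series f /\
  exists c : n.-tuple 'I_n.+1 -> int,
    (forall la, is_partition la -> (0 <= c la)%R) /\
    (forall m, f m = (\sum_(la | is_partition la) c la * schur (parts la) m)%R).

Definition patterns (L : seq (seq nat)) : {set 'S_3} :=
  [set pi : 'S_3 | oneline pi \in L].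

Notation w123 := [:: 1; 2; 3] (only parsing).
Notation w132 := [:: 1; 3; 2] (only parsing).
Notation w213 := [:: 2; 1; 3] (only parsing).
Notation w231 := [:: 2; 3; 1] (only parsing).
Notation w312 := [:: 3; 1; 2] (only parsing).
Notation w321 := [:: 3; 2; 1] (only parsing).

Definition symmetric_pattern_sets : seq {set 'S_3} :=
  [:: set0;
      patterns [:: w123];
      patterns [:: w321];
      patterns [:: w132; w213];
      patterns [:: w132; w312];
      patterns [:: w213; w231];
      patterns [:: w231; w312];
      patterns [:: w123; w132; w312];
      patterns [:: w123; w213; w231];
      patterns [:: w123; w231; w312];
      patterns [:: w132; w213; w321];
      patterns [:: w132; w312; w321];
      patterns [:: w213; w231; w321];
      patterns [:: w132; w213; w231; w312];
      patterns [:: w123; w132; w213; w231; w312];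
      patterns [:: w132; w213; w231; w312; w321]].

(* Main.v *)
Require Import Defs.
From mathcomp Require Import all_boot all_order all_fingroup all_algebra.
From mathcomp Require Import finmap multiset zify.

(** A coefficient of Q_n counts permutations whose descents are strict ascents
    of a sorted word, and standardization turns these permutations into the
    words of a given content.  Robinson-Schensted insertion maps such words
    bijectively to pairs of a semistandard tableau and a recording, so any
    condition on words that depends on the recording only gives a nonnegative
    combination of Schur functions.  Avoiding 123 says that the first row of
    the tableau has length at most 2, and avoiding 321 that it has at most two
    rows.  Recordings detect the descents of a word, hence products of complete
    homogeneous functions expand unitriangularly in Schur functions; solving
    for the latter shows that they are symmetric.

    Each other set on the list amounts to a rule giving the comparison of the
    outer entries of a triple from the comparisons of neighbours, so that each
    descent set is realised once or never, according to its size k.  Summing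
    F_S over all S of size k gives the hook Schur function s_(n-k,1^k).

    Conversely, the symmetry of Q_3 and Q_4 leaves only the sets of the list. *)

Set Implicit Arguments.
Unset Strict Implicit.
Unset Printing Implicit Defensive.

Import GRing.Theory.
Local Open Scope mset_scope.
Local Open Scope nat_scope.

(** * Row insertion and its inverse *)

(** A recording is kept as a lattice word, the list of the rows where boxes appear, rather than as a
    standard tableau. Together with the padding by empty rows this makes the shape equal to the
    content of the recording, as a list of fixed length.

    Insertion sees the patterns 123 and 321 because both are their own inverses: it is the inverse
    of a permutation that is the standardization of its word.

    Triangularity is measured by the sum of the row indices in a recording. This sum depends on the
    shape only; weakly increasing blocks of given lengths bound it, and exactly one recording
    reaches the bound.

    The rules behind the remaining sets are conjunction, disjunction and the two projections, which
    are all the idempotent operations on booleans, and all associative. Associativity makes the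
    predicted comparison of two entries independent of the entry chosen between them; idempotence
    excludes cyclic comparisons. Together they turn every prescription of ascents and descents into
    a linear order. *)

Definition dominates (r s : seq nat) : bool :=
  (size s <= size r) && all (fun p => p.1 < p.2) (zip r s).

Definition tableau (T : seq (seq nat)) : bool :=
  all (sorted leq) T && sorted dominates T.

(** When no entry exceeds [x], [find] returns [size r] and [set_nth] appends [x], so bumping and
    appending share one formula. *)
Definition row_insert (x : nat) (r : seq nat) : seq nat :=
  set_nth 0 r (find (ltn x) r) x.

Fixpoint insert (x : nat) (T : seq (seq nat)) : seq (seq nat) * nat :=
  if T is r :: T' then
    let p := find (ltn x) r in
    if p < size r then
      let: (T'', i) := insert (nth 0 r p) T' in (row_insert x r :: T'', i.+1)
    else (row_insert x r :: T', 0)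
  else ([:: [:: x]], 0).

(** Reverse bumping: the last box of row [i] is removed and its letter travels upwards. In a sorted
    row with an entry below [y], the index [(find (leq y) r).-1] is that of the last such entry, the
    only one that [y] can have been bumped by. *)
Fixpoint extract (i : nat) (T : seq (seq nat)) : seq (seq nat) * nat :=
  if T is r :: T' then
    if i is i'.+1 then
      let: (T'', y) := extract i' T' in
      let p := (find (leq y) r).-1 in (set_nth 0 r p y :: T'', nth 0 r p)
    else (take (size r).-1 r :: T', last 0 r)
  else ([::], 0).

Lemma dominatesP r s :
  reflect (size s <= size r /\ forall j, j < size s -> nth 0 r j < nth 0 s j)
          (dominates r s).
Proof.
apply: (iffP andP) => -[le_sr H]; split=> //.
  move=> j lt_js; have lt_jz : j < size (zip r s) by rewrite size_zip; lia.
  by have /(_ j lt_jz) := all_nthP (0, 0) H; rewrite nth_zip_cond lt_jz.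
apply/(all_nthP (0, 0)) => j lt_jz; rewrite nth_zip_cond lt_jz /=.
by apply: H; move: lt_jz; rewrite size_zip; lia.
Qed.

Lemma sorted_leq_nthP s :
  reflect (forall i j, i <= j -> j < size s -> nth 0 s i <= nth 0 s j)
          (sorted leq s).
Proof.
apply: (iffP idP) => [s_sorted i j le_ij lt_js | H].
  by apply: (sorted_leq_nth leq_trans leqnn 0 s_sorted); rewrite ?inE; lia.
by apply/(sortedP 0) => i lt_is; apply: H.
Qed.

Lemma row_insert_bump x r (p := find (ltn x) r) :
  sorted leq r ->
  (forall j, j < p -> j < size r -> nth 0 r j <= x) /\
  (forall j, p <= j -> j < size r -> x < nth 0 r j).
Proof.
move=> /sorted_leq_nthP r_le; split=> j le_pj lt_jr.
  by have := before_find 0 le_pj; rewrite /= => /negbT; rewrite -leqNgt.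
apply: leq_trans (r_le p j le_pj lt_jr).
by apply: (nth_find 0 (a := ltn x)); rewrite has_find -/p; lia.
Qed.

Lemma nth_row_insert x r j :
  nth 0 (row_insert x r) j = if j == find (ltn x) r then x else nth 0 r j.
Proof. by rewrite /row_insert nth_set_nth /=. Qed.

Lemma size_row_insert x r :
  size (row_insert x r) =
  if find (ltn x) r < size r then size r else (size r).+1.
Proof.
rewrite /row_insert size_set_nth; have := find_size (ltn x) r.
by case: ltnP; lia.
Qed.

Lemma sorted_row_insert x r : sorted leq r -> sorted leq (row_insert x r).
Proof.
move=> r_sorted; have [r_le r_gt] := row_insert_bump x r_sorted.
have le_pr := find_size (ltn x) r.
apply/sorted_leq_nthP => i j le_ij; rewrite size_row_insert !nth_row_insert.
move/sorted_leq_nthP: r_sorted => r_mono lt_jr.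
case: (eqVneq i (find _ _)) => [eq_ip|ne_ip]; case: (eqVneq j (find _ _)) => [eq_jp|ne_jp] //.
- have lt_pj : find (ltn x) r < j by lia.
  by apply/ltnW/r_gt; move: lt_jr; case: ifP; lia.
- by apply: r_le; lia.
- by apply: r_mono => //; move: lt_jr; case: ifP; lia.
Qed.

Lemma perm_row_insert x r (p := find (ltn x) r) :
  p < size r -> perm_eq (nth 0 r p :: row_insert x r) (x :: r).
Proof.
move=> lt_pr; rewrite /row_insert set_nthE -/p lt_pr.
rewrite -[in X in perm_eq _ X](cat_take_drop p r) (drop_nth 0 lt_pr).
by apply/seq.permP => a; rewrite /= !count_cat /=; lia.
Qed.

Lemma row_insert_end x r :
  size r <= find (ltn x) r -> row_insert x r = rcons r x.
Proof.
move=> le_rp; have /eqP p_eq : find (ltn x) r == size r.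
  by rewrite eqn_leq find_size.
by rewrite /row_insert set_nthE p_eq ltnn subnn cats1.
Qed.

(** Columns stay strict because bumping moves weakly to the left: the entry below the bumped letter
    [y] is larger than [y], so [y] enters the next row in a column [q <= p], below an entry that is
    at most [x] and hence smaller than [y]. *)
Lemma dominates_row_insert x r s (p := find (ltn x) r) :
    sorted leq r -> sorted leq s -> dominates r s -> p < size r ->
  dominates (row_insert x r) (row_insert (nth 0 r p) s).
Proof.
move=> r_sorted s_sorted /dominatesP [le_sr lt_rs] lt_pr.
have [r_le r_gt] := row_insert_bump x r_sorted; rewrite -/p in r_le r_gt.
set y := nth 0 r p; have lt_xy : x < y by apply: r_gt.
have [s_le s_gt] := row_insert_bump y s_sorted.
have le_qs := find_size (ltn y) s; set q := find (ltn y) s in s_le s_gt le_qs *.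
have le_qp : q <= p.
  rewrite leqNgt; apply/negP => lt_pq.
  have lt_ps : p < size s by lia.
  by have := s_le p lt_pq lt_ps; rewrite leqNgt lt_rs.
apply/dominatesP; split; first by rewrite !size_row_insert -/p -/q lt_pr; case: ifP; lia.
move=> j; rewrite size_row_insert !nth_row_insert -/p -/q => lt_j.
case: (eqVneq j q) => [->|ne_jq].
  case: (eqVneq q p) => [//|ne_qp].
  by apply: leq_ltn_trans lt_xy; apply: r_le; lia.
have lt_js : j < size s by move: lt_j; case: ifP; lia.
case: (eqVneq j p) => [eq_jp|_]; last exact: lt_rs.
by apply: ltn_trans lt_xy _; rewrite /y -eq_jp lt_rs.
Qed.

Lemma tableau_cons r T :
  tableau (r :: T) =
  [&& sorted leq r, tableau T & (T == [::]) || dominates r (head [::] T)].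
Proof.
rewrite /tableau /=; case: T => [|s T] /=; first by rewrite !andbT.
by case: (sorted leq r); case: (all _ _); case: (sorted leq s);
   case: (dominates r s); rewrite ?andbF ?andbT.
Qed.

Lemma insert_cons x r T (p := find (ltn x) r) :
  insert x (r :: T) =
  if p < size r then
    (row_insert x r :: (insert (nth 0 r p) T).1, (insert (nth 0 r p) T).2.+1)
  else (row_insert x r :: T, 0).
Proof. by rewrite /= -/p; case: ifP => // _; case: insert. Qed.

Lemma head_insert x T : head [::] (insert x T).1 = row_insert x (head [::] T).
Proof. by case: T => [|r T] //; rewrite insert_cons; case: ifP. Qed.

Lemma insert_neq0 x T : (insert x T).1 == [::] = false.
Proof. by case: T => [|r T] //; rewrite insert_cons; case: ifP. Qed.

Lemma shape_insert x T :
  shape (insert x T).1 = incr_nth (shape T) (insert x T).2.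
Proof.
elim: T x => [|r T IH] x //; rewrite insert_cons.
by case: ifP => lt_p /=; rewrite ?IH size_row_insert lt_p.
Qed.

Lemma perm_insert x T : perm_eq (flatten (insert x T).1) (x :: flatten T).
Proof.
elim: T x => [|r T IH] x //; rewrite insert_cons; case: ifP => lt_p /=.
  apply: perm_trans (perm_cat (perm_refl _) (IH _)) _.
  rewrite -cat1s perm_catCA /= -cat_cons -[in X in perm_eq _ X]cat_cons.
  by rewrite perm_cat2r perm_row_insert.
by rewrite row_insert_end ?cat_rcons 1?leqNgt ?lt_p // -cat_cons -(cat1s x) perm_catCA.
Qed.

Lemma tableau_insert x T : tableau T -> tableau (insert x T).1.
Proof.
elim: T x => [|r T IH] x //; rewrite tableau_cons insert_cons.
case/and3P=> r_sorted tabT domT; case: ifP => lt_p /=; rewrite tableau_cons.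
  rewrite sorted_row_insert // IH // insert_neq0 head_insert dominates_row_insert //.
    by case: T tabT {IH domT} => [//|s T]; rewrite tableau_cons => /andP[].
  by case/orP: domT => // /eqP ->; rewrite /dominates /=; case: (r).
rewrite sorted_row_insert // tabT; case/orP: domT => [->|/dominatesP [le_r lt_r]] //=.
rewrite row_insert_end 1?leqNgt ?lt_p //; apply/orP; right; apply/dominatesP.
rewrite size_rcons; split=> [|j lt_j]; first by lia.
by rewrite nth_rcons (leq_trans lt_j le_r) lt_r.
Qed.

Lemma sorted_dominates_size T i j :
  sorted dominates T -> i <= j -> nth 0 (shape T) j <= nth 0 (shape T) i.
Proof.
move=> T_sorted le_ij.
have [lt_jT|le_Tj] := ltnP j (size T); last by rewrite nth_default ?size_map.
have: sorted geq (shape T).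
  by rewrite sorted_map; apply: sub_sorted T_sorted => r s /andP[].
have geq_trans : transitive geq by move=> a b c ba ac; apply: leq_trans ac ba.
by move=> /(sorted_leq_nth geq_trans leqnn 0); apply; rewrite ?inE ?size_map //; lia.
Qed.

(* Every row above the one where a box appears is nonempty. *)
Lemma insert_index x T : (insert x T).2 <= sumn (shape T).
Proof.
elim: T x => [|r T IH] x //; rewrite insert_cons; case: ifP => //= lt_p.
by have := IH (nth 0 r (find (ltn x) r)); lia.
Qed.

Lemma extract_row y r (p := (find (leq y) r).-1) :
  sorted leq r -> has (fun z => z < y) r ->
  [/\ p < size r, nth 0 r p < y & forall j, p < j -> j < size r -> y <= nth 0 r j].
Proof.
move=> r_sorted /(has_nthP 0) [k lt_kr lt_ky]; set q := find (leq y) r.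
have le_qr : q <= size r by apply: find_size.
have lt_kq : k < q.
  rewrite ltnNge; apply/negP => le_qk; have lt_qr : q < size r by lia.
  have: y <= nth 0 r q by apply: (nth_find 0 (a := leq y)); rewrite has_find.
  by move/sorted_leq_nthP: r_sorted => /(_ q k le_qk lt_kr); lia.
have lt_pq : p < q by rewrite /p -/q; lia.
split; [by lia | |].
  by have := before_find 0 lt_pq; rewrite /= => /negbT; rewrite -ltnNge.
move=> j lt_pj lt_jr; have le_qj : q <= j by rewrite /p -/q in lt_pj; lia.
have: y <= nth 0 r q by apply: (nth_find 0 (a := leq y)); rewrite has_find -/q; lia.
by move/leq_trans; apply; move/sorted_leq_nthP: r_sorted; apply.
Qed.

Lemma find_unique (a : pred nat) s p :
    p <= size s -> (forall j, j < p -> ~~ a (nth 0 s j)) ->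
    (p < size s -> a (nth 0 s p)) ->
  find a s = p.
Proof.
move=> le_ps not_a a_p; case: (ltngtP (find a s) p) => // cmp.
  have := not_a _ cmp; rewrite nth_find // has_find; lia.
have := before_find 0 cmp; rewrite a_p //; have := find_size a s; lia.
Qed.

(** The bound [i < size T] says that the new box lies in an existing, possibly empty, row. A row
    created by the insertion would be left behind empty by [extract]; padding avoids this. *)
Lemma extract_insert x T T' i :
  all (sorted leq) T -> insert x T = (T', i) -> i < size T -> extract i T' = (T, x).
Proof.
elim: T x T' i => [//|r T IH] x T' i /= /andP[r_sorted T_sorted].
have le_pr := find_size (ltn x) r; have [r_le r_gt] := row_insert_bump x r_sorted.
set p := find (ltn x) r in le_pr r_le r_gt *.
case: ifP => lt_pr; last first.
  case=> <- <- _ /=; rewrite row_insert_end 1?leqNgt ?lt_pr //.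
  by rewrite size_rcons last_rcons -cats1 take_size_cat.
case Ey: (insert _ T) => [T1 i1] [<- <-] /= lt_iT.
rewrite (IH _ _ _ T_sorted Ey lt_iT); set y := nth 0 r p.
have lt_xy : x < y by apply: r_gt.
(* Once [x] has replaced [y] in column [p], the entries up to [p] are at most [x < y] and the later
   ones are at least [y]. *)
have -> : find (leq y) (row_insert x r) = p.+1.
  apply: find_unique; rewrite ?size_row_insert -/p ?lt_pr //.
    move=> j; rewrite nth_row_insert -/p => le_jp; rewrite -ltnNge.
    case: eqVneq => // ne_jp; apply: leq_ltn_trans lt_xy; apply: r_le; lia.
  move=> lt_p1r; rewrite nth_row_insert -/p; case: eqVneq => [|_]; first by lia.
  by move/sorted_leq_nthP: r_sorted; apply.
rewrite /= nth_row_insert -/p eqxx; congr ((_ :: _), _).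
rewrite /row_insert set_set_nth eqxx; apply: (@eq_from_nth _ 0).
  by rewrite size_set_nth -/p; lia.
by move=> j _; rewrite nth_set_nth /=; case: eqP => // ->.
Qed.

(* The first row produced is recorded because the dominance of the next row
   up is checked against it. *)
Lemma insert_extract T' i T x :
    tableau T' -> i < size T' ->
    nth 0 (shape T') i.+1 < nth 0 (shape T') i -> extract i T' = (T, x) ->
  [/\ tableau T, insert x T = (T', i), size T = size T' &
      exists q, [/\ q < size (head [::] T'),
        nth 0 (head [::] T') q <= x,
        forall j, q < j -> j < size (head [::] T) -> x < nth 0 (head [::] T) j,
        size (head [::] T) <= size (head [::] T') &
        [/\ (forall j, j < size (head [::] T) ->
              nth 0 (head [::] T') j <= nth 0 (head [::] T) j) &
        q < size (head [::] T) -> x < nth 0 (head [::] T) q]]].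
Proof.
elim: i T' T x => [|i IH] [//|r T'] T x; rewrite tableau_cons => /and3P[r_sorted tabT' domT'].
  move=> _ /= corner [<- <-].
  have r_gt0 : 0 < size r by lia.
  have r_eq : r = rcons (take (size r).-1 r) (last 0 r).
    by case/lastP: (r) r_gt0 => // r' z _; rewrite size_rcons last_rcons -cats1 take_size_cat ?cats1.
  have sz : size (take (size r).-1 r) = (size r).-1 by rewrite size_take; case: ifP; lia.
  have find_eq : find (ltn (last 0 r)) (take (size r).-1 r) = (size r).-1.
    apply: find_unique; rewrite ?sz ?ltnn //.
    move=> j lt_j; rewrite -leqNgt nth_take // -nth_last.
    by move/sorted_leq_nthP: r_sorted; apply; lia.
  split=> //.
  - rewrite tableau_cons take_sorted // tabT'; case/orP: domT' => [->|] //.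
    move=> /dominatesP [le_s lt_s]; apply/orP; right; apply/dominatesP; rewrite sz.
    have hd: size (head [::] T') < size r.
      by case: (T') corner => [|s T1] //=; lia.
    split; first by lia.
    by move=> j lt_j; rewrite nth_take ?lt_s //; lia.
  - rewrite /= find_eq sz ltnn row_insert_end ?find_eq ?sz //.
    by rewrite -r_eq.
  - exists (size r).-1; rewrite sz nth_last; split=> //; try lia.
    split=> [j lt_j|]; first by rewrite nth_take.
    by rewrite ltnn.
move=> /= lt_iT'; case Ey: (extract i T') => [T1 y] corner [<- <-].
have [tabT1 insT1 szT1 [q [lt_qs le_sqy lt_after le_size [le_nth lt_q]]]] :=
  IH _ _ _ tabT' lt_iT' corner Ey.
have T'_neq0 : T' != [::] by case: (T') lt_iT'.
have {domT'} /dominatesP [le_sr lt_rs] : dominates r (head [::] T').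
  by move: domT'; rewrite (negPf T'_neq0).
have has_y : has (fun z => z < y) r.
  apply/(has_nthP 0); exists q; first by lia.
  by apply: leq_trans le_sqy; apply: lt_rs.
have [lt_pr lt_py ge_py] := extract_row r_sorted has_y.
set p := (find (leq y) r).-1 in lt_pr lt_py ge_py *; set x' := nth 0 r p.
have r_mono := elimT (sorted_leq_nthP r) r_sorted.
(* Going up, the reverse path moves weakly to the right: [q] is the column that [y] leaves in the
   row below, and the entry above it is smaller than [y], whereas [p] is the last column with this
   property. *)
have le_qp : q <= p.
  rewrite leqNgt; apply/negP => lt_pq; have := ge_py q lt_pq.
  by have := lt_rs q lt_qs; lia.
have sz : size (set_nth 0 r p y) = size r by rewrite size_set_nth; lia.
have find_eq : find (ltn x') (set_nth 0 r p y) = p.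
  apply: find_unique; first by rewrite sz ltnW.
    move=> j lt_jp; rewrite nth_set_nth /= (ltn_eqF lt_jp) -leqNgt.
    by apply: r_mono; rewrite // ltnW.
  by rewrite nth_set_nth /= eqxx.
have row_eq : row_insert x' (set_nth 0 r p y) = r.
  rewrite /row_insert find_eq set_set_nth eqxx; apply: (@eq_from_nth _ 0).
    by rewrite size_set_nth; lia.
  by move=> j _; rewrite nth_set_nth /=; case: eqP => // ->.
split=> //.
- rewrite tableau_cons tabT1; apply/and3P; split=> //.
    apply/sorted_leq_nthP => a b le_ab; rewrite sz !nth_set_nth /= => lt_br.
    case: (eqVneq a p) => [eq_ap|ne_ap]; case: (eqVneq b p) => [eq_bp|ne_bp] //.
    + by apply: ge_py; lia.
    + by apply/ltnW/(leq_ltn_trans _ lt_py)/r_mono; lia.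
    + exact: r_mono.
  apply/orP; right; apply/dominatesP; rewrite sz; split; first by lia.
  move=> j lt_j; rewrite nth_set_nth /=; case: (eqVneq j p) => [eq_jp|ne_jp].
    have [lt_qp|le_pq] := ltnP q p; first by apply: lt_after; lia.
    have <- : q = j by lia.
    by apply: lt_q; lia.
  apply: leq_trans (le_nth j lt_j); apply: lt_rs; lia.
- by rewrite insert_cons find_eq sz lt_pr nth_set_nth /= eqxx insT1 row_eq.
- by rewrite /= szT1.
- exists p => /=; rewrite sz; split=> //.
    move=> j lt_pj lt_jr; rewrite nth_set_nth /=; case: eqVneq => [|_]; first by lia.
    by apply: leq_trans lt_py _; apply: ge_py.
  split=> [j lt_j|_]; rewrite nth_set_nth /=; last by rewrite eqxx.
  by case: eqVneq => [->|//]; apply: ltnW.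
Qed.

(** * The Robinson-Schensted correspondence on words *)

Definition rsk_step (x : nat) (TR : seq (seq nat) * seq nat) :=
  ((insert x TR.1).1, (insert x TR.1).2 :: TR.2).

(* The letters are inserted from right to left, into a tableau padded with
   empty rows to exactly N rows. *)
Definition rsk (N : nat) (v : seq nat) : seq (seq nat) * seq nat :=
  foldr rsk_step (nseq N [::], [::]) v.

Fixpoint unrsk (r : seq nat) (T : seq (seq nat)) : seq nat :=
  if r is i :: r' then (extract i T).2 :: unrsk r' (extract i T).1 else [::].

Definition content (N : nat) (r : seq nat) : seq nat :=
  [seq count_mem i r | i <- iota 0 N].

(** Yamanouchi words read from the right: a box may enter row [i] only while that row is shorter
    than the row above. They encode standard tableaux by the row of each entry. *)
Fixpoint lattice (r : seq nat) : bool :=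
  if r is i :: r' then
    ((i == 0) || (count_mem i r' < count_mem i.-1 r')) && lattice r'
  else true.

Definition recording (N : nat) (r : seq nat) : bool :=
  all (gtn N) r && lattice r.

Lemma size_content N r : size (content N r) = N.
Proof. by rewrite size_map size_iota. Qed.

Lemma nth_content N r i : i < N -> nth 0 (content N r) i = count_mem i r.
Proof. by move=> lt_iN; rewrite (nth_map 0) ?size_iota // nth_iota. Qed.

Lemma content_cons N i r :
  i < N -> content N (i :: r) = incr_nth (content N r) i.
Proof.
move=> lt_iN; apply: (@eq_from_nth _ 0).
  by rewrite size_incr_nth !size_content lt_iN.
by rewrite size_content => j lt_jN; rewrite nth_incr_nth !nth_content //=; lia.
Qed.

Lemma sumn_incr_nth s i : sumn (incr_nth s i) = (sumn s).+1.
Proof.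
elim: s i => [|x s IH] [|i] //=; first by elim: i => //= i ->.
by rewrite IH addnS.
Qed.

Lemma sumn_content N r : all (gtn N) r -> sumn (content N r) = size r.
Proof.
elim: r => [|i r IH] /=; first by rewrite /content /=; elim: (iota 0 N).
by case/andP=> lt_iN /IH {}IH; rewrite content_cons // sumn_incr_nth IH.
Qed.

Lemma lattice_count r i j :
  lattice r -> i <= j -> count_mem j r <= count_mem i r.
Proof.
move=> r_lat; elim: j => [|j IH]; first by case: i.
rewrite leq_eqVlt => /predU1P[-> //|/IH le_ji]; apply: leq_trans le_ji.
elim: r r_lat {IH} => [//|k r IH] /= /andP[cond /IH le_r].
move: cond; case: (eqVneq k j.+1) => [->|_ _] /=; first by lia.
by rewrite add0n (leq_trans le_r) ?leq_addl.
Qed.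

Lemma shape_flatten_size (T : seq (seq nat)) : sumn (shape T) = size (flatten T).
Proof. by rewrite size_flatten. Qed.

(** A new box appears in a row whose index is at most the number of boxes already present, so [N]
    rows of padding suffice for [N] letters. The lattice condition holds because the shape stays a
    partition. *)
Lemma rskP N v (R := rsk N v) : size v <= N ->
  [/\ tableau R.1, shape R.1 = content N R.2, recording N R.2,
      perm_eq (flatten R.1) v & size R.2 = size v].
Proof.
rewrite {}/R; elim: v => [|x v IH] /= => [_|lt_vN].
  split=> //; last by elim: N => //= N ->.
  - apply/andP; split; first by rewrite all_nseq orbT.
    by case: N => //= N; elim: N => //= N ->.
  - by apply: (@eq_from_nth _ 0); rewrite size_map size_nseq ?size_content //
         => i lt_iN; rewrite nth_content // (nth_map [::]) ?size_nseq // nth_nseq lt_iN.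
have [tabT shT recR permT szR] := IH (ltnW lt_vN).
set R := rsk N v in tabT shT recR permT szR *; set i := (insert x R.1).2.
have lt_iN : i < N.
  apply: leq_ltn_trans lt_vN; rewrite -(perm_size permT) -shape_flatten_size.
  exact: insert_index.
have shT' : shape (insert x R.1).1 = content N (i :: R.2).
  by rewrite shape_insert shT content_cons.
have tabT' := tableau_insert x tabT.
split=> //=; last by rewrite szR.
- move: recR => /andP[all_r lat_r]; rewrite /recording /= lt_iN all_r lat_r andbT /=.
  case: (posnP i) => //= i_gt0.
  have /andP[_ /sorted_dominates_size /(_ (leq_pred i))] := tabT'.
  rewrite shT' !nth_content ?(leq_ltn_trans (leq_pred i)) //= eqxx.
  have -> : i == i.-1 = false by lia.
  by rewrite add1n add0n andbT.
- by apply: perm_trans (perm_insert x _) _; rewrite perm_cons.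
Qed.

Lemma size_rsk N v : size v <= N -> size (rsk N v).1 = N.
Proof.
by case/rskP=> _ shT _ _ _; rewrite -(size_map size) [map _ _]shT size_content.
Qed.

Lemma rskK N v : size v <= N -> unrsk (rsk N v).2 (rsk N v).1 = v.
Proof.
elim: v => [//|x v IH] /= lt_vN; have le_vN := ltnW lt_vN.
have [/andP[T_sorted _] shT _ permT _] := rskP le_vN.
set R := rsk N v in IH T_sorted shT permT *.
have lt_i : (insert x R.1).2 < size R.1.
  rewrite size_rsk //; apply: leq_ltn_trans (insert_index _ _) _.
  by rewrite shape_flatten_size (perm_size permT).
by rewrite (extract_insert T_sorted (surjective_pairing _) lt_i) /= IH.
Qed.

Lemma unrskK N r T :
    recording N r -> tableau T -> shape T = content N r ->
  rsk N (unrsk r T) = (T, r).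
Proof.
elim: r T => [|i r IH] T /= recr tabT shT.
  rewrite /rsk /=; congr (_, _); apply: (@eq_from_nth _ [::]).
    by rewrite -(size_map size T) [map _ _]shT size_content size_nseq.
  rewrite size_nseq => i lt_iN; rewrite nth_nseq lt_iN; apply/esym/size0nil.
  rewrite -(nth_map [::] 0) ?[map _ _]shT ?nth_content //.
  by rewrite -(size_map size T) [map _ _]shT size_content.
have recr' : recording N r by move: recr => /andP[/andP[_ ?] /andP[_ ?]]; apply/andP.
have lt_iN : i < N by case/andP: recr => /andP[].
have szT : size T = N by rewrite -(size_map size T) [map _ _]shT size_content.
have lt_iT : i < size T by rewrite szT.
(* The content of [r] is weakly decreasing and row [i] has one box more than it. In the last row,
   [i.+1 = N], the default 0 stands for the missing row. *)
have corner : nth 0 (shape T) i.+1 < nth 0 (shape T) i.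
  rewrite shT (nth_content _ lt_iN) /= eqxx add1n ltnS; have [lt_i1N|le_Ni1] := ltnP i.+1 N.
    rewrite nth_content //= (ltn_eqF (ltnSn i)) add0n.
    by apply: lattice_count => //; case/andP: recr'.
  by rewrite nth_default ?size_content.
have [tab' ins' sz' _] := insert_extract tabT lt_iT corner (surjective_pairing _).
have sh' : shape (extract i T).1 = content N r.
  have := shape_insert (extract i T).2 (extract i T).1.
  rewrite ins' /= shT content_cons // => eq_incr; apply: (@eq_from_nth _ 0).
    by rewrite size_content size_map sz'.
  move=> j _; have := congr1 (fun s => nth 0 s j) eq_incr.
  by rewrite !nth_incr_nth; lia.
by rewrite /rsk_step IH //= ins'.
Qed.

Lemma semistandard_tableau la w :
  sorted geq la -> size w = sumn la -> semistandard la w = tableau (reshape la w).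
Proof.
move=> la_sorted sz_w; rewrite /semistandard sz_w eqxx /= /tableau; congr andb.
have sh_eq : shape (reshape la w) = la by rewrite reshapeKl ?sz_w.
rewrite -sh_eq in la_sorted; elim: (reshape la w) la_sorted => [//|r T IH].
case: T IH => [//|s T] IH /= /andP[le_sr T_sorted].
by rewrite /dominates le_sr /=; congr andb; apply: IH.
Qed.

Lemma content_sorted N r : lattice r -> sorted geq (content N r).
Proof.
move=> r_lat; apply/(sortedP 0) => i; rewrite size_content => lt_iN.
by rewrite !nth_content // ?(ltnW lt_iN) //; apply: lattice_count.
Qed.

(** For a fixed recording, taking the reading word of the insertion tableau is a bijection: [r]
    determines the shape, so [reshape] recovers the tableau from its word, and [unrsk r] recovers
    the inserted word from the tableau. *)
Lemma count_rsk_fiber n (s r : seq nat) :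
    size s = n -> size r = n -> recording n r ->
  count (fun v => (rsk n v).2 == r) (permutations s) =
  count (semistandard (content n r)) (permutations s).
Proof.
move=> sz_s sz_r recr; rewrite -!size_filter.
have sz_v v : v \in permutations s -> size v = n.
  by rewrite mem_permutations => /perm_size ->.
have sem_tab w : size w = n ->
    semistandard (content n r) w = tableau (reshape (content n r) w).
  move=> sz_w; rewrite semistandard_tableau ?content_sorted //; first by case/andP: recr.
  by rewrite sumn_content ?sz_r //; case/andP: recr.
rewrite -(size_map (fun v => flatten (rsk n v).1)); apply/perm_size/uniq_perm.
- rewrite map_inj_in_uniq ?filter_uniq ?permutations_uniq // => v v'.
  rewrite !mem_filter => /andP[/eqP rv /sz_v sv] /andP[/eqP rv' /sz_v sv'] eq_fl.
  have [_ shv _ _ _] := @rskP n v (eq_leq sv).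
  have [_ shv' _ _ _] := @rskP n v' (eq_leq sv').
  rewrite -(@rskK n v (eq_leq sv)) -(@rskK n v' (eq_leq sv')) rv rv'; congr unrsk.
  by rewrite -[LHS]flattenK -[RHS]flattenK eq_fl shv shv' rv rv'.
- by rewrite filter_uniq ?permutations_uniq.
move=> w; apply/mapP/idP => [[v]|].
  rewrite mem_filter => /andP[/eqP rv v_in] ->; have sv := sz_v v v_in.
  have [tabv shv _ permv _] := @rskP n v (eq_leq sv).
  rewrite mem_filter mem_permutations (perm_trans permv) -?mem_permutations //.
  by rewrite andbT sem_tab ?(perm_size permv) // -rv -shv flattenK.
rewrite mem_filter => /andP[sem_w w_in]; have sw := sz_v w w_in.
rewrite sem_tab // in sem_w.
have sum_n : sumn (content n r) = n by rewrite sumn_content ?sz_r //; case/andP: recr.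
have shw : shape (reshape (content n r) w) = content n r by rewrite reshapeKl ?sum_n ?sw.
have rskw := unrskK recr sem_w shw.
have fl_w : flatten (reshape (content n r) w) = w by rewrite reshapeKr ?sum_n ?sw.
set v := unrsk _ _ in rskw; exists v; last by rewrite rskw /= fl_w.
have sv : size v = n.
  by rewrite -sz_r /v; elim: (r) (reshape _ _) => //= i r' IH T; rewrite IH.
rewrite mem_filter rskw eqxx /= mem_permutations.
have [_ _ _ permv _] := @rskP n v (eq_leq sv).
rewrite rskw fl_w /= perm_sym in permv.
by rewrite (perm_trans permv) // -mem_permutations.
Qed.

(** Serves both partitions and recordings of size [n], whose entries are at most [n]. Sums over
    either then range over the same finite type. *)
Definition padded_tuple n (s : seq nat) : n.-tuple 'I_n.+1 :=
  [tuple inord (nth 0 s i) | i < n].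

Lemma parts_padded_tuple n s :
  size s = n -> all (geq n) s -> parts (padded_tuple n s) = s.
Proof.
move=> sz_s /(all_nthP 0) le_s; rewrite /parts; apply: (@eq_from_nth _ 0).
  by rewrite size_map size_tuple sz_s.
rewrite size_map size_tuple => i lt_in; rewrite (nth_map ord0) ?size_tuple //.
rewrite -[i]/(nat_of_ord (Ordinal lt_in)) -tnth_nth tnth_mktuple inordK //.
by rewrite ltnS; apply: le_s; rewrite sz_s.
Qed.

Lemma parts_inj n : injective (@parts n).
Proof. by move=> la mu /(inj_map val_inj)/val_inj. Qed.

Lemma size_parts n (la : n.-tuple 'I_n.+1) : size (parts la) = n.
Proof. by rewrite size_map size_tuple. Qed.

Lemma eq_padded_tuple n s (la : n.-tuple 'I_n.+1) :
  size s = n -> all (geq n) s -> (padded_tuple n s == la) = (s == parts la).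
Proof.
by move=> sz_s le_s; rewrite -(inj_eq (@parts_inj n)) parts_padded_tuple.
Qed.

Lemma recording_le n r : recording n r -> all (geq n) r.
Proof. by case/andP=> all_r _; apply: sub_all all_r => i /ltnW. Qed.

(** The multiplicity of the Schur function of [la]. For [P = predT] it is the number of standard
    tableaux of shape [la]; for [P = blocks leq (rev (parts mu))] it is a Kostka number, since
    weakly increasing blocks add horizontal strips. *)
Definition nb_recordings n (P : pred (seq nat)) (la : n.-tuple 'I_n.+1) : nat :=
  #|[pred r : n.-tuple 'I_n.+1 |
     [&& recording n (parts r), P (parts r) & content n (parts r) == parts la]]|.

Lemma content_le n r : size r = n -> all (geq n) (content n r).
Proof. by move=> <-; apply/allP => _ /mapP[i _ ->]; apply: count_size. Qed.

(** The fibre over a recording depends on it only through its content, so [P] enters only through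
    the multiplicities. *)
Lemma count_rsk n (P : pred (seq nat)) (s : seq nat) : size s = n ->
  count (fun v => P (rsk n v).2) (permutations s) =
  \sum_(la : n.-tuple 'I_n.+1 | is_partition la)
     nb_recordings P la * count (semistandard (parts la)) (permutations s).
Proof.
move=> sz_s.
have rec_v v : v \in permutations s -> recording n (rsk n v).2 /\ size (rsk n v).2 = n.
  rewrite mem_permutations => /perm_size; rewrite sz_s => sv.
  by have [_ _ ? _ ->] := @rskP n v (eq_leq sv).
have -> : count (fun v => P (rsk n v).2) (permutations s) =
    \sum_(r : n.-tuple 'I_n.+1 | recording n (parts r) && P (parts r))
       count (semistandard (content n (parts r))) (permutations s).
  rewrite -sum1_count big_seq_cond.
  rewrite (partition_big (fun v => padded_tuple n (rsk n v).2)
     (fun r => recording n (parts r) && P (parts r))) /=; last first.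
    move=> v /andP[/rec_v [recv szv] Pv].
    by rewrite parts_padded_tuple ?recording_le // recv.
  apply: eq_bigr => r /andP[recr Pr].
  rewrite -count_rsk_fiber ?size_parts // -sum1_count [RHS]big_seq_cond.
  apply: eq_bigl => v; apply/andP/andP => [[/andP[v_in _]]|[v_in /eqP eq_v]].
    by have [? ?] := rec_v v v_in; rewrite eq_padded_tuple ?recording_le.
  have [? ?] := rec_v v v_in.
  by rewrite v_in eq_v eq_padded_tuple -?eq_v ?recording_le // eq_v Pr.
rewrite (partition_big (fun r : n.-tuple 'I_n.+1 => padded_tuple n (content n (parts r)))
     (@is_partition n)) /=; last first.
  move=> r /andP[/andP[all_r lat_r] _].
  rewrite /is_partition parts_padded_tuple ?size_content ?content_le ?size_parts //.
  by rewrite content_sorted // sumn_content // size_parts eqxx.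
apply: eq_bigr => la _; rewrite -sum_nat_const.
apply: eq_big => [r|r /andP[_ /eqP]].
  by rewrite inE eq_padded_tuple ?size_content ?content_le ?size_parts // andbA.
move/(congr1 (@parts n)); rewrite parts_padded_tuple ?size_content ?content_le ?size_parts //.
by move->.
Qed.

(** * Symmetry of Schur functions *)

(** The row bumping lemma. If [y <= x], the path of [x] runs strictly to the right of the path of
    [y]; otherwise it runs weakly to the left. In either case the letters bumped into the next row
    compare as [x] and [y] do, which is what the induction needs. *)
Lemma insert_index_leq x y T :
    all (sorted leq) T ->
  ((insert x (insert y T).1).2 <= (insert y T).2) = (y <= x).
Proof.
elim: T x y => [|r T IH] x y /=; first by case: (ltnP x y).
case/andP=> r_sorted T_sorted; have [r_le r_gt] := row_insert_bump y r_sorted.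
have r'_sorted := sorted_row_insert y r_sorted.
have [r'_le r'_gt] := row_insert_bump x r'_sorted.
have := insert_cons y r T; rewrite /= => ->.
set p := find (ltn y) r in r_le r_gt *.
set q := find (ltn x) (row_insert y r) in r'_le r'_gt *.
have le_qr' : q <= size (row_insert y r) by apply: find_size.
have sz_r' := size_row_insert y r; rewrite -/p in sz_r'.
have nth_r' := nth_row_insert y r; rewrite -/p in nth_r'.
case: ifP sz_r' => lt_pr sz_r'; rewrite [(_, _).1]/= insert_cons -/q /=.
  have lt_yy' : y < nth 0 r p by apply: r_gt.
  case: (leqP y x) => [le_yx|lt_xy].
    case: ifP => //= lt_qr'; rewrite ltnS IH //.
    have lt_pq : p < q.
      rewrite ltnNge; apply/negP => le_qp; have := r'_gt q (leqnn q) lt_qr'.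
      rewrite nth_r'; case: eqVneq => [_|ne_qp]; first by lia.
      by have := r_le q; lia.
    rewrite nth_r' gtn_eqF //.
    by move/sorted_leq_nthP: r_sorted; apply; lia.
  have le_qp : q <= p.
    rewrite leqNgt; apply/negP => lt_pq.
    by have := r'_le p lt_pq; rewrite sz_r' nth_r' eqxx => /(_ lt_pr); lia.
  have -> : q < size (row_insert y r) by rewrite sz_r'; lia.
  rewrite /= ltnS IH //; apply/negbTE; rewrite -ltnNge; apply: leq_ltn_trans lt_yy'.
  have := elimT (sorted_leq_nthP _) r'_sorted q p le_qp.
  by rewrite sz_r' (nth_r' p) eqxx; apply.
have p_eq : p = size r.
  by apply/eqP; rewrite eqn_leq find_size leqNgt lt_pr.
case: (leqP y x) => [le_yx|lt_xy].
  case: ifP => // lt_qr'; have := r'_gt q (leqnn q) lt_qr'.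
  rewrite nth_r'; case: eqVneq => [_|ne_qp]; first by lia.
  by have := r_le q; lia.
suff -> : q < size (row_insert y r) by [].
rewrite ltnNge; apply/negP => le_r'q.
by have := r'_le p; rewrite nth_r' eqxx; lia.
Qed.

Lemma tableau_rsk N v : tableau (rsk N v).1.
Proof.
elim: v => [|x v IH] /=; last exact: tableau_insert.
apply/andP; split; first by rewrite all_nseq orbT.
by case: N => //= N; elim: N => //= N ->.
Qed.

Lemma size_rsk_recording N v : size (rsk N v).2 = size v.
Proof. by elim: v => //= x v ->. Qed.

Lemma rsk_descents N v k : k.+1 < size v ->
  (nth 0 (rsk N v).2 k <= nth 0 (rsk N v).2 k.+1) = (nth 0 v k.+1 <= nth 0 v k).
Proof.
elim: v k => [//|x v IH] [|k] /= lt_k; last exact: IH.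
case: v lt_k {IH} => [//|y v] _ /=.
by rewrite insert_index_leq //; case/andP: (tableau_rsk N v).
Qed.

Lemma eq_sorted_nth (e e' : rel nat) (v r : seq nat) :
    size v = size r ->
    (forall k, k.+1 < size v ->
       e (nth 0 v k) (nth 0 v k.+1) = e' (nth 0 r k) (nth 0 r k.+1)) ->
  sorted e v = sorted e' r.
Proof.
move=> eq_sz eq_e; apply/(sortedP 0)/(sortedP 0) => H i lt_i.
  by rewrite -eq_e ?eq_sz // H ?eq_sz.
by rewrite eq_e // H -?eq_sz.
Qed.

Lemma eq_sorted_reshape (e e' : rel nat) bs (v r : seq nat) :
    size v = size r ->
    (forall k, k.+1 < size v ->
       e (nth 0 v k) (nth 0 v k.+1) = e' (nth 0 r k) (nth 0 r k.+1)) ->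
  all (sorted e) (reshape bs v) = all (sorted e') (reshape bs r).
Proof.
elim: bs v r => [//|b bs IH] v r eq_sz eq_e /=; congr andb.
  apply: eq_sorted_nth => [|k]; first by rewrite !size_take eq_sz.
  by rewrite size_take_min => lt_k; rewrite !nth_take ?eq_e //; lia.
apply: IH => [|k]; first by rewrite !size_drop eq_sz.
by rewrite size_drop => lt_k; rewrite !nth_drop !addnS eq_e //; lia.
Qed.

(* Up to reversal, the words counted here are the products of weakly
   increasing blocks of prescribed lengths: they give the coefficients of
   products of complete homogeneous functions. *)
Definition blocks (e : rel nat) (bs v : seq nat) : bool :=
  all (sorted e) (reshape bs v).

Lemma blocks_rsk N bs v : blocks leq bs (rsk N v).2 = blocks geq bs v.
Proof.
apply: eq_sorted_reshape; first by rewrite size_rsk_recording.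
by move=> k; rewrite size_rsk_recording => /rsk_descents; apply.
Qed.

(** Renaming letters destroys the monotonicity of the blocks, and sorting each block restores it. A
    block is determined by its multiset of letters, so the inverse renaming undoes this: products of
    complete homogeneous functions are symmetric. *)
Definition sort_blocks (g : nat -> nat) (bs v : seq nat) : seq nat :=
  flatten [seq sort geq [seq g x | x <- b] | b <- reshape bs v].

Lemma geq_total : total geq. Proof. by move=> x y; apply: leq_total. Qed.

Lemma geq_trans : transitive geq.
Proof. by move=> x y z le_xy le_zx; apply: leq_trans le_zx le_xy. Qed.

Lemma geq_anti : antisymmetric geq.
Proof. by move=> x y; rewrite andbC => /anti_leq. Qed.

Lemma perm_sort_blocks g bs v :
  size v = sumn bs -> perm_eq (sort_blocks g bs v) [seq g x | x <- v].
Proof.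
move=> sz_v; have le_v : size v <= sumn bs by rewrite sz_v.
rewrite -[in X in perm_eq _ X](reshapeKr le_v) map_flatten /sort_blocks.
elim: (reshape bs v) => //= b B IH; apply: perm_cat => //; exact/permPl/perm_sort.
Qed.

Lemma reshape_sort_blocks g bs v : size v = sumn bs ->
  reshape bs (sort_blocks g bs v) =
  [seq sort geq [seq g x | x <- b] | b <- reshape bs v].
Proof.
move=> sz_v; rewrite -[RHS]flattenK; congr (reshape _ _).
rewrite /shape -map_comp -[LHS](@reshapeKl _ _ v) ?sz_v //.
by apply: eq_map => b; rewrite /= size_sort size_map.
Qed.

Lemma sort_blocksK g g' bs v : cancel g g' -> size v = sumn bs ->
  blocks geq bs v -> sort_blocks g' bs (sort_blocks g bs v) = v.
Proof.
move=> gK sz_v v_blocks.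
rewrite {1}/sort_blocks reshape_sort_blocks // -map_comp.
rewrite -[RHS](@reshapeKr _ bs) ?sz_v //; congr flatten.
rewrite -[RHS]map_id; apply/eq_in_map => b b_in /=.
apply: (sorted_eq geq_trans geq_anti).
- exact: sort_sorted geq_total _.
- exact: (allP v_blocks).
rewrite perm_sort; apply: perm_trans (perm_map g' (permEl (perm_sort _ _))) _.
by rewrite (mapK gK).
Qed.

Lemma leq_count_blocks g g' bs s s' :
    cancel g g' -> size s = sumn bs -> perm_eq s' [seq g x | x <- s] ->
  count (blocks geq bs) (permutations s) <= count (blocks geq bs) (permutations s').
Proof.
move=> gK sz_s perm_s'; rewrite -!size_filter -(size_map (sort_blocks g bs)).
have sz_v v : v \in permutations s -> size v = sumn bs.
  by rewrite mem_permutations => /perm_size ->.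
apply: uniq_leq_size.
  rewrite map_inj_in_uniq ?filter_uniq ?permutations_uniq // => v w.
  rewrite !mem_filter => /andP[bv /sz_v sv] /andP[bw /sz_v sw] eq_vw.
  by rewrite -(sort_blocksK gK sv bv) eq_vw (sort_blocksK gK sw bw).
move=> _ /mapP[v + ->]; rewrite !mem_filter => /andP[bv v_in].
have sv := sz_v v v_in; apply/andP; split.
  rewrite /blocks reshape_sort_blocks // all_map; apply/allP => b _ /=.
  exact: sort_sorted geq_total _.
rewrite mem_permutations (perm_trans (perm_sort_blocks _ sv)) //.
rewrite perm_sym (perm_trans perm_s') // perm_map // perm_sym.
by rewrite -mem_permutations.
Qed.

Lemma count_blocks_rename g bs s s' :
    bijective g -> size s = sumn bs -> perm_eq s' [seq g x | x <- s] ->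
  count (blocks geq bs) (permutations s') = count (blocks geq bs) (permutations s).
Proof.
case=> g' gK g'K sz_s perm_s'; apply/eqP; rewrite eqn_leq; apply/andP; split.
  apply: (leq_count_blocks g'K); first by rewrite (perm_size perm_s') size_map.
  have := perm_map g' perm_s'.
  by rewrite (mapK gK) perm_sym.
exact: leq_count_blocks gK _ _.
Qed.

(** For [bs = rev la] this is the statistic $n(\lambda)=\sum_i i\lambda_i$, with rows numbered from
    0. It replaces the dominance order in the triangularity argument. *)
Fixpoint weight (bs : seq nat) : nat :=
  if bs is b :: bs' then b * size bs' + weight bs' else 0.

(** The extremal recording: each block fills a row of its own, the rightmost block filling the top
    row. For [bs = rev la] the resulting shape is [la]. *)
Fixpoint canonical (bs : seq nat) : seq nat :=
  if bs is b :: bs' then nseq b (size bs') ++ canonical bs' else [::].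

(* A block of weakly increasing row indices, read from right to left, starts
   at most one row below the rows already in use. *)
Lemma lattice_blocks_bound bs r :
    lattice r -> blocks leq bs r -> size r = sumn bs ->
  [/\ all (gtn (size bs)) r, sumn r <= weight bs &
      sumn r = weight bs -> r = canonical bs].
Proof.
elim: bs r => [|b bs IH] r r_lat; first by move=> _ /size0nil ->.
rewrite /blocks /= => /andP[b_sorted bs_sorted] sz_r.
set r1 := take b r in b_sorted; set r2 := drop b r in bs_sorted.
have r_cat : r = r1 ++ r2 by rewrite cat_take_drop.
have sz_r1 : size r1 = b by rewrite size_take sz_r; case: ltnP; lia.
have sz_r2 : size r2 = sumn bs by rewrite size_drop sz_r; lia.
have lat_r2 : lattice r2.
  by move: r_lat; rewrite r_cat; elim: (r1) => //= i r1' IHr /andP[_ /IHr].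
have [bound2 le2 eq2] := IH r2 lat_r2 bs_sorted sz_r2.
have bound1 : all (geq (size bs)) r1.
  (* The block increases weakly, so it suffices to bound its last letter [e]. The lattice condition
     at [e] makes [e.-1] occur in [r2], where all letters are below [size bs]. *)
  have [-> //|[r1' [e r1_eq]]] : r1 = [::] \/ exists r1' e, r1 = rcons r1' e.
    by case/lastP: (r1) => [|r1' e]; [left | right; exists r1', e].
  have le_e : e <= size bs.
    have: lattice (e :: r2).
      move: r_lat; rewrite r_cat r1_eq cat_rcons.
      by elim: (r1') => //= i r1'' IHr /andP[_ /IHr].
    move=> /= /andP[/predU1P[-> //|lt_e] _].
    have: e.-1 \in r2 by rewrite -has_pred1 has_count (leq_ltn_trans _ lt_e).
    by move/(allP bound2) => /=; lia.
  move: b_sorted; rewrite r1_eq => /sorted_leq_nthP r1_le.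
  apply/(all_nthP 0) => k; rewrite size_rcons => lt_k /=.
  have := r1_le k (size r1'); rewrite size_rcons [nth 0 _ (size r1')]nth_rcons ltnn eqxx.
  by move=> /(_ lt_k (leqnn _)) /leq_trans; apply.
have le1 : sumn r1 <= b * size bs.
  by rewrite -sz_r1; elim: (r1) bound1 => //= i r1' IHr /andP[le_i /IHr]; lia.
split.
- rewrite r_cat all_cat; apply/andP; split; apply: sub_all.
  + by move=> i; apply: id.
  + exact: bound1.
  + by move=> i; apply: leqW.
  + exact: bound2.
- by rewrite r_cat sumn_cat leq_add.
rewrite {1}r_cat sumn_cat => eq_sum; rewrite r_cat eq2; last by lia.
congr (_ ++ _); have: sumn r1 = b * size bs by lia.
rewrite -sz_r1; elim: (r1) bound1 => //= i r1' IHr /andP[le_i bnd].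
have le_r1' : sumn r1' <= size r1' * size bs.
  by elim: (r1') bnd => //= j r1'' IHj /andP[le_j /IHj]; lia.
by move=> eq_i; rewrite -IHr //; last lia; congr cons; lia.
Qed.

Lemma weight_rcons bs a : weight (rcons bs a) = weight bs + sumn bs.
Proof. by elim: bs => [|b bs IH] /=; rewrite ?muln0 // IH size_rcons; lia. Qed.

Lemma weight_rev_incr_nth la i : i < size la ->
  weight (rev (incr_nth la i)) = weight (rev la) + i.
Proof.
elim: la i => [//|a la IH] [|i] /= lt_i; rewrite !rev_cons !weight_rcons ?addn0 //.
by rewrite IH // !sumn_rev sumn_incr_nth; lia.
Qed.

(** Each box contributes the index of its row, so the sum depends on the shape alone. Bounds on the
    sums of recordings thereby become inequalities between shapes. *)
Lemma sumn_recording N r : all (gtn N) r -> sumn r = weight (rev (content N r)).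
Proof.
elim: r => [_|i r IH /= /andP[lt_iN all_r]].
  rewrite /content /=; elim: (iota 0 N) => //= k s IHs.
  by rewrite rev_cons weight_rcons -IHs sumn_rev /=; elim: s {IHs}.
by rewrite content_cons // weight_rev_incr_nth ?size_content // -IH // addnC.
Qed.

Lemma count_canonical bs i : count_mem i (canonical bs) = nth 0 (rev bs) i.
Proof.
elim: bs => [|b bs IH] /=; first by rewrite nth_nil.
rewrite count_cat IH rev_cons nth_rcons size_rev count_nseq /=.
case: ltngtP => [_|lt_i|eq_i]; rewrite ?mul0n ?mul1n //.
  by rewrite nth_default // size_rev ltnW.
by rewrite nth_default ?size_rev ?eq_i ?addn0.
Qed.

Lemma content_canonical n la : size la = n -> content n (canonical (rev la)) = la.
Proof.
move=> sz_la; apply: (@eq_from_nth _ 0); rewrite size_content ?sz_la // => i lt_in.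
by rewrite nth_content // count_canonical revK.
Qed.

Lemma size_canonical bs : size (canonical bs) = sumn bs.
Proof. by elim: bs => //= b bs IH; rewrite size_cat size_nseq IH. Qed.

Lemma lattice_canonical bs : sorted leq bs -> lattice (canonical bs).
Proof.
elim: bs => [//|a bs IH] bs_sorted /=.
have {}IH := IH (path_sorted bs_sorted).
elim: {-2}a (leqnn a) => [//|k IHk] lt_ka /=; rewrite IHk ?(ltnW lt_ka) // andbT.
case: bs bs_sorted {IH IHk} => [//|b bs] /= /andP[le_ab _].
rewrite !count_cat !count_nseq /= eqxx.
rewrite !count_canonical [nth 0 _ (size bs).+1]nth_default ?size_rev //.
by rewrite (gtn_eqF (ltnSn _)) (ltn_eqF (ltnSn _)); lia.
Qed.

Lemma blocks_canonical bs : blocks leq bs (canonical bs).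
Proof.
elim: bs => [//|b bs IH]; rewrite /blocks /=.
rewrite take_size_cat ?drop_size_cat ?size_nseq // -/(blocks _ _ _) IH andbT.
by case: b => //= b; elim: b => //= b ->; rewrite leqnn.
Qed.

Lemma all_canonical bs : all (gtn (size bs)) (canonical bs).
Proof.
elim: bs => //= b bs IH; rewrite all_cat all_nseq /= ltnSn orbT /=.
by apply: sub_all IH => i; apply: leqW.
Qed.

Lemma nb_recordings_diag n (mu : n.-tuple 'I_n.+1) : is_partition mu ->
  0 < nb_recordings (blocks leq (rev (parts mu))) mu.
Proof.
case/andP=> mu_sorted /eqP mu_sum; apply/card_gt0P.
have sz_can : size (canonical (rev (parts mu))) = n.
  by rewrite size_canonical sumn_rev mu_sum.
have all_can : all (gtn n) (canonical (rev (parts mu))).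
  by have := all_canonical (rev (parts mu)); rewrite size_rev size_parts.
have rec_can : recording n (canonical (rev (parts mu))).
  by rewrite /recording all_can lattice_canonical // rev_sorted.
exists (padded_tuple n (canonical (rev (parts mu)))).
rewrite inE parts_padded_tuple // ?recording_le //.
by rewrite rec_can blocks_canonical content_canonical ?size_parts /=.
Qed.

(** A recording of the same weight as [mu] would have to be the canonical one, whose content is
    [mu]. *)
Lemma nb_recordings_triangular n (mu la : n.-tuple 'I_n.+1) :
    is_partition mu -> la != mu ->
    0 < nb_recordings (blocks leq (rev (parts mu))) la ->
  weight (rev (parts la)) < weight (rev (parts mu)).
Proof.
case/andP=> mu_sorted /eqP mu_sum ne_la_mu /card_gt0P[r].
rewrite inE => /and3P[/andP[all_r lat_r] blk /eqP cont_r].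
have [|_] := lattice_blocks_bound lat_r blk; first by rewrite size_parts sumn_rev mu_sum.
rewrite (sumn_recording all_r) cont_r leq_eqVlt => /predU1P[eq_w|//].
move=> /(_ eq_w) r_can; case/negP: ne_la_mu; apply/eqP/parts_inj.
by rewrite -cont_r r_can content_canonical ?size_parts.
Qed.

Lemma semistandard_size la w : semistandard la w -> size w = sumn la.
Proof. by case/and3P=> /eqP. Qed.

Lemma count_semistandard_neq la s :
  size s != sumn la -> count (semistandard la) (permutations s) = 0.
Proof.
move=> ne_s; apply/eqP; rewrite -leqn0 leqNgt -has_count; apply/hasPn => w.
rewrite mem_permutations => /perm_size sz_w; apply/negP => /semistandard_size.
by move/eqP; rewrite sz_w (negPf ne_s).
Qed.

(** The number of block words for [rev (parts la)] is invariant under renaming and expands in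
    semistandard counts. Apart from [la], the shapes with nonzero coefficient have smaller weight,
    so induction on the weight isolates the term of [la]. *)
Lemma count_semistandard_rename n (la : n.-tuple 'I_n.+1) g s s' :
    is_partition la -> bijective g -> perm_eq s' [seq g x | x <- s] ->
  count (semistandard (parts la)) (permutations s') =
  count (semistandard (parts la)) (permutations s).
Proof.
move=> la_part g_bij perm_s'; have sz_s' : size s' = size s.
  by rewrite (perm_size perm_s') size_map.
have [w le_w] := ubnP (weight (rev (parts la))).
elim: w la la_part le_w => // w IH la la_part; rewrite ltnS => le_w.
have /andP[_ /eqP la_sum] := la_part.
have [sz_s|ne_s] := eqVneq (size s) n; last first.
  by rewrite !count_semistandard_neq ?la_sum ?sz_s'.
have blk_sz : size s = sumn (rev (parts la)) by rewrite sumn_rev la_sum.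
have expand u : size u = n ->
    count (blocks geq (rev (parts la))) (permutations u) =
    \sum_(mu : n.-tuple 'I_n.+1 | is_partition mu)
      nb_recordings (blocks leq (rev (parts la))) mu *
      count (semistandard (parts mu)) (permutations u).
  by move=> sz_u; rewrite -count_rsk //; apply: eq_count => v; rewrite blocks_rsk.
have := count_blocks_rename g_bij blk_sz perm_s'.
rewrite !expand ?sz_s' // (bigD1 la) //= [in RHS](bigD1 la) //=.
set A := \sum_(_ | _) _; set B := \sum_(_ | _) _.
have -> : A = B.
  apply: eq_bigr => mu /andP[mu_part ne_mu].
  case: (posnP (nb_recordings (blocks leq (rev (parts la))) mu)) => [-> //|c_gt0].
  congr (_ * _); apply: IH => //; apply: leq_trans le_w.
  exact: nb_recordings_triangular la_part ne_mu c_gt0.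
(* The other terms agree by induction, and the coefficient of [la] is positive, so it cancels. *)
by move/addIn/eqP; rewrite eqn_pmul2l ?nb_recordings_diag // => /eqP.
Qed.

(** * Words without monotone subsequences of length 3 *)

Lemma mem_natP (s : seq nat) (z : nat) :
  z \in s <-> exists2 k, k < size s & nth 0 s k = z.
Proof. by split=> [/(nthP 0)|[k lt_k <-]] //; apply: mem_nth. Qed.

Definition first_row (v : seq nat) : seq nat := foldr row_insert [::] v.

Lemma first_row_cons x v : first_row (x :: v) = row_insert x (first_row v).
Proof. by []. Qed.

(** The letters expelled from the first row, the latest one in front. Since words are inserted from
    the right, this is exactly the word inserted into the remaining rows, which gives access to the
    rows one at a time. *)
Fixpoint bumped (v : seq nat) : seq nat :=
  if v is x :: v' then
    let p := find (ltn x) (first_row v') in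
    if p < size (first_row v') then nth 0 (first_row v') p :: bumped v'
    else bumped v'
  else [::].

Lemma rsk_rows N v :
  (rsk N.+1 v).1 = first_row v :: (rsk N (bumped v)).1.
Proof.
elim: v => [//|x v IH]; rewrite [LHS]/= IH insert_cons [bumped (_ :: _)]/=.
by case: ifP.
Qed.

Lemma sorted_first_row v : sorted leq (first_row v).
Proof. by elim: v => //= x v; apply: sorted_row_insert. Qed.

Lemma perm_first_row v : perm_eq (first_row v ++ bumped v) v.
Proof.
elim: v => //= x v IH; case: ifP => lt_p.
  rewrite -cat_rcons (perm_trans (y := x :: first_row v ++ bumped v)) ?perm_cons //.
  rewrite -cat_cons perm_cat2r perm_rcons; exact: perm_row_insert.
by rewrite row_insert_end ?cat_rcons 1?leqNgt ?lt_p // -cat1s perm_catCA perm_cons.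
Qed.

Lemma mem_first_row v (y : nat) : (y \in v) = (y \in first_row v) || (y \in bumped v).
Proof. by rewrite -(perm_mem (perm_first_row v)) mem_cat. Qed.

Lemma first_row_bump (x : nat) v (z : nat) : z \in first_row v -> x < z ->
  exists2 w, bumped (x :: v) = w :: bumped v & x < w <= z.
Proof.
case/mem_natP=> k lt_k <- lt_xz.
have [r_le r_gt] := row_insert_bump x (sorted_first_row v).
set p := find _ _ in r_le r_gt.
have le_pk : p <= k by rewrite leqNgt; apply/negP => /r_le /(_ lt_k); rewrite leqNgt lt_xz.
have lt_p : p < size (first_row v) by apply: leq_ltn_trans lt_k.
exists (nth 0 (first_row v) p); first by rewrite /= -/p lt_p.
by rewrite r_gt //; have /sorted_leq_nthP := sorted_first_row v; apply.
Qed.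

Lemma bumped_cons x v : bumped (x :: v) = bumped v \/
  exists w : nat, [/\ bumped (x :: v) = w :: bumped v, w \in first_row v, x < w &
                forall z : nat, z \in first_row (x :: v) -> z < w -> z <= x].
Proof.
rewrite [bumped (_ :: _)]/=; case: ifP => lt_p; [right | by left].
have [r_le r_gt] := row_insert_bump x (sorted_first_row v).
set p := find _ _ in lt_p r_le r_gt *.
exists (nth 0 (first_row v) p); split=> //; [exact: mem_nth | exact: r_gt |].
move=> z; rewrite first_row_cons => /mem_natP[k]; rewrite size_row_insert -/p lt_p => lt_k <-.
rewrite nth_row_insert -/p; case: eqVneq => // ne_kp lt_w; apply: r_le => //.
rewrite ltnNge; apply/negP => le_pk.
by have /sorted_leq_nthP/(_ p k le_pk lt_k) := sorted_first_row v; lia.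
Qed.

Lemma mem_first_row_cons (x : nat) v (z : nat) :
  z \in first_row (x :: v) -> z = x \/ z \in first_row v.
Proof.
rewrite first_row_cons => /mem_natP[k]; rewrite size_row_insert => lt_k <-.
rewrite nth_row_insert; case: eqVneq => [_|ne_k]; [by left | right].
apply/mem_natP; exists k => //.
by move: lt_k (find_size (ltn x) (first_row v)); case: ifP; lia.
Qed.

Lemma first_row_keep (x : nat) v (z : nat) : z \in first_row v ->
  z \in first_row (x :: v) \/ bumped (x :: v) = z :: bumped v.
Proof.
case/mem_natP=> k lt_k <-; case: (eqVneq k (find (ltn x) (first_row v))) => [eq_k|ne_k].
  by right; rewrite /= -eq_k lt_k.
left; rewrite first_row_cons; apply/mem_natP; exists k; last by rewrite nth_row_insert (negPf ne_k).
by rewrite size_row_insert; case: ifP; lia.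
Qed.

(* In the word read from right to left, [t] comes after [y]. *)
Lemma bumped_witness v (y z : nat) :
    y \in bumped v -> z \in first_row v -> z < y ->
  exists2 t : nat, z <= t < y & subseq [:: t; y] v.
Proof.
elim: v y z => [//|x v IH] y z.
have old : y \in bumped v -> z \in first_row (x :: v) -> z < y ->
    exists2 t : nat, z <= t < y & subseq [:: t; y] (x :: v).
  move=> y_in /mem_first_row_cons[->|z_in] lt_zy.
    by exists x; rewrite ?leqnn //= eqxx sub1seq mem_first_row y_in orbT.
  have [t le_t sub_t] := IH y z y_in z_in lt_zy.
  by exists t => //; apply: subseq_trans sub_t (subseq_cons _ _).
case: (bumped_cons x v) => [->|[w [-> w_in lt_xw le_x]]]; first exact: old.
rewrite inE => /predU1P[->|] //; move=> z_in lt_zw; exists x.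
  by rewrite le_x.
by rewrite /= eqxx sub1seq mem_first_row w_in.
Qed.

(** The pair increases as written, so it decreases strictly in the order of insertion; likewise for
    [has_triple]. *)
Definition has_pair (v : seq nat) : Prop :=
  exists y z : nat, z < y /\ subseq [:: z; y] v.

Definition has_triple (v : seq nat) : Prop :=
  exists a b c : nat, c < b < a /\ subseq [:: c; b; a] v.

Lemma subseq_has_pair v v' : subseq v v' -> has_pair v -> has_pair v'.
Proof.
by move=> sub_v [y [z [lt_zy sub_zy]]]; exists y, z; split=> //; apply: subseq_trans sub_v.
Qed.

Lemma subseq_bumped x v : subseq (bumped v) (bumped (x :: v)).
Proof. by case: (bumped_cons x v) => [->|[w [-> _ _ _]]] //; apply: subseq_cons. Qed.

(** When [b] enters after the larger [a], some letter larger than [b] has been bumped. As long as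
    [b] stays in the first row the second alternative holds; if [b] is bumped later, it lands in
    front of that letter and forms a pair. *)
Lemma pair_bumped v (a b : nat) : subseq [:: b; a] v -> b < a ->
  has_pair (bumped v) \/
  b \in first_row v /\ exists2 y : nat, y \in bumped v & b < y.
Proof.
elim: v => [//|x v IH] sub_ba lt_ba.
have [sub_v|[eq_bx a_in]] : subseq [:: b; a] v \/ b = x /\ a \in v.
  by move: sub_ba => /=; case: eqP => [->|_ ?]; [rewrite sub1seq; right | left].
  have sub_b := subseq_bumped x v.
  have [pairB|[b_in [y y_in lt_by]]] := IH sub_v lt_ba.
    by left; apply: subseq_has_pair pairB.
  have [b_in'|eq_B] := first_row_keep x b_in.
    by right; split=> //; exists y => //; apply: (mem_subseq sub_b).
  left; exists y, b; split=> //; rewrite eq_B /= eqxx sub1seq //.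
subst b; right; split.
  rewrite first_row_cons; apply/mem_natP; exists (find (ltn x) (first_row v)).
    by rewrite size_row_insert; have := find_size (ltn x) (first_row v); case: ifP; lia.
  by rewrite nth_row_insert eqxx.
move: a_in; rewrite mem_first_row => /orP[a_in|a_in].
  have [w -> /andP[lt_xw _]] := first_row_bump a_in lt_ba.
  by exists w => //; rewrite inE eqxx.
by exists a => //; apply: (mem_subseq (subseq_bumped x v)).
Qed.

Lemma bumped_neq0 v : bumped v <> [::] <-> has_pair v.
Proof.
split=> [|[y [z [lt_zy sub_zy]]]].
  elim: v => [//|x v IH].
  case: (bumped_cons x v) => [->|[w [_ w_in lt_xw _]] _].
    by move/IH; apply: subseq_has_pair; apply: subseq_cons.
  by exists w, x; split=> //=; rewrite eqxx sub1seq mem_first_row w_in.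
have [[? [? [_ /size_subseq]]]|[_ [w + _]]] := pair_bumped sub_zy lt_zy.
  by case: bumped.
by case: bumped.
Qed.

(** One round of bumping shortens these subsequences by one letter. A second round, by
    [bumped_neq0], decides whether the third row is empty. *)
Lemma has_pair_bumped v : has_pair (bumped v) <-> has_triple v.
Proof.
elim: v => [|x v [IH1 IH2]]; first by split=> [[? [? []]]|[? [? [? []]]]].
split=> [|[a [b [c [/andP[lt_cb lt_ba] sub_cba]]]]].
  have old : has_pair (bumped v) -> has_triple (x :: v).
    move/IH1 => [a [b [c [lt_cba sub_cba]]]]; exists a, b, c; split=> //.
    exact: subseq_trans sub_cba (subseq_cons _ _).
  case: (bumped_cons x v) => [->|[w [-> w_in lt_xw _]]]; first exact: old.
  case=> y [z [lt_zy]] /=; case: eqP => [eq_zw|_ sub_zy]; last first.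
    by apply: old; exists y, z.
  subst z; rewrite sub1seq => y_in.
  (* [w] itself may have been inserted before [y], so it cannot serve as the middle letter. The
     witness [t] lies in front of [y], with [w <= t < y], and [x < w] makes [x], [t], [y] a
     triple. *)
  have [t /andP[le_wt lt_ty] sub_t] := bumped_witness y_in w_in lt_zy.
  by exists y, t, x; rewrite (leq_trans lt_xw) // lt_ty /= eqxx.
have sub_b := subseq_bumped x v.
have [sub_v|[eq_cx sub_v]] : subseq [:: c; b; a] v \/ c = x /\ subseq [:: b; a] v.
  by move: sub_cba; rewrite [subseq _ (_ :: _)]/=; case: eqP => [->|_ ?]; [right | left].
  by apply: (subseq_has_pair sub_b); apply: IH2; exists a, b, c; rewrite lt_cb.
subst c; have [pairB|[b_in [y y_in lt_by]]] := pair_bumped sub_v lt_ba.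
  exact: subseq_has_pair pairB.
have [w -> /andP[lt_xw le_wb]] := first_row_bump b_in lt_cb.
by exists y, w; split; [lia | rewrite /= eqxx sub1seq].
Qed.

Lemma third_row_nil N v :
  nth [::] (rsk N.+3 v).1 2 = [::] <-> ~ has_triple v.
Proof.
rewrite !rsk_rows /=.
have -> : first_row (bumped (bumped v)) = [::] <-> bumped (bumped v) = [::].
  case: (bumped (bumped v)) => [//|x w]; split=> // /(congr1 size).
  by rewrite first_row_cons size_row_insert; case: (first_row w) => //= y r; case: ifP.
rewrite -has_pair_bumped -bumped_neq0; split=> [-> //|].
by case: (bumped (bumped v)) => // x w [].
Qed.

(** Half of Schensted's invariant: entry [p] of the first row is the least head of a weakly
    decreasing subsequence of length [p.+1]. Here it is attained; [first_row_complete] shows that it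
    is a lower bound. *)
Lemma first_row_sound v p : p < size (first_row v) ->
  exists s, [/\ subseq s v, sorted geq s, size s = p.+1 &
                head 0 s = nth 0 (first_row v) p].
Proof.
elim: v p => [//|x v IH] p; rewrite first_row_cons => lt_p; rewrite nth_row_insert.
have [r_le r_gt] := row_insert_bump x (sorted_first_row v).
case: eqVneq => [p_eq|ne_p].
  case: p p_eq lt_p => [|p] p_eq lt_p.
    by exists [:: x]; rewrite /= eqxx sub0seq.
  have lt_pr : p < size (first_row v).
    by have := find_size (ltn x) (first_row v); rewrite -p_eq.
  have [s [sub_s s_sorted sz_s hd_s]] := IH p lt_pr.
  exists (x :: s); split=> //=; rewrite ?eqxx ?sz_s //.
  case: s s_sorted hd_s {sz_s sub_s} => [//|y s] /= -> ->; rewrite andbT.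
  by apply: r_le; rewrite -?p_eq.
have [|s [sub_s s_sorted sz_s hd_s]] := IH p.
  by move: lt_p; rewrite size_row_insert; have := find_size (ltn x) (first_row v); case: ifP; lia.
by exists s; split=> //; apply: subseq_trans sub_s (subseq_cons _ _).
Qed.

Lemma first_row_complete v y s : subseq (y :: s) v -> sorted geq (y :: s) ->
  size s < size (first_row v) /\ nth 0 (first_row v) (size s) <= y.
Proof.
elim: v y s => [//|x v IH] y s sub_ys ys_sorted; rewrite first_row_cons.
have [r_le r_gt] := row_insert_bump x (sorted_first_row v).
have le_p := find_size (ltn x) (first_row v).
have [sub_v|[eq_yx sub_v]] : subseq (y :: s) v \/ y = x /\ subseq s v.
  by move: sub_ys; rewrite [subseq _ (_ :: _)]/=; case: eqP => [->|_ ?]; [right | left].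
  have [lt_s le_y] := IH y s sub_v ys_sorted.
  split; first by rewrite size_row_insert; case: ifP; lia.
  rewrite nth_row_insert; case: eqVneq => // eq_s; apply: leq_trans le_y.
  by apply/ltnW/r_gt => //; rewrite eq_s.
subst y; set p := find _ _ in r_le r_gt le_p.
have [lt_s|lt_p] : size s < p \/ size s = p.
- case: s sub_v ys_sorted {sub_ys} => [|z s] sub_v /=; first by case: (p); [right | left].
  case/andP=> le_zx zs_sorted; have [lt_s le_z] := IH z s sub_v zs_sorted.
  have: size s < p.
    by rewrite ltnNge; apply/negP => le_ps; have := r_gt _ le_ps lt_s; lia.
  by rewrite leq_eqVlt => /predU1P[]; [right | left].
- split; first by rewrite size_row_insert -/p; case: ifP; lia.
  by rewrite nth_row_insert -/p (ltn_eqF lt_s) r_le //; lia.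
- rewrite size_row_insert nth_row_insert -/p lt_p eqxx; split=> //.
  by case: ifP; lia.
Qed.

Lemma first_row_size v k :
  (size (first_row v) <= k) <->
  ~ exists s, [/\ subseq s v, sorted geq s & size s = k.+1].
Proof.
split=> [le_k [[|y s] [sub_s s_sorted]] //= [sz_s]|no_s].
  by have [] := first_row_complete sub_s s_sorted; rewrite sz_s; lia.
rewrite leqNgt; apply/negP => /first_row_sound[s [sub_s s_sorted sz_s _]].
by case: no_s; exists s.
Qed.

(** * Permutations and the coefficients of Q *)

Lemma size_oneline n (sigma : 'S_n) : size (oneline sigma) = n.
Proof. by rewrite size_map size_enum_ord. Qed.

Lemma nth_oneline n (sigma : 'S_n) (i : 'I_n) :
  nth 0 (oneline sigma) i = (sigma i).+1.
Proof. by rewrite (nth_map i) ?size_enum_ord // nth_ord_enum. Qed.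

Lemma oneline_inj n : injective (@oneline n).
Proof.
move=> sigma tau eq_w; apply/permP => i; apply/val_inj/eqP.
by rewrite -eqSS -!nth_oneline eq_w.
Qed.

Lemma mem_Des n (sigma : 'S_n) (s : 'I_n.-1) :
  (s \in Des sigma) = (nth 0 (oneline sigma) s.+1 < nth 0 (oneline sigma) s).
Proof. by rewrite inE. Qed.

Lemma oneline_nth_inj n (sigma : 'S_n) i j : i < n -> j < n ->
  nth 0 (oneline sigma) i = nth 0 (oneline sigma) j -> i = j.
Proof.
move=> lt_i lt_j.
rewrite -[i]/(val (Ordinal lt_i)) -[j]/(val (Ordinal lt_j)) !nth_oneline.
by move=> [] /val_inj /perm_inj ->.
Qed.

(** The permutation sends each element to its rank, the number of elements below it. *)
Lemma perm_of_order n (r : rel 'I_n) :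
    irreflexive r -> transitive r -> (forall i j, i != j -> r i j || r j i) ->
  exists sigma : 'S_n, forall i j, (sigma i < sigma j) = r i j.
Proof.
move=> r_irr r_trans r_total.
have rank_lt i j : r i j -> #|[pred k | r k i]| < #|[pred k | r k j]|.
  move=> r_ij; apply: proper_card; apply/properP; split.
    by apply/subsetP => k; rewrite !inE => /r_trans; apply.
  by exists i; rewrite !inE ?r_irr.
have rank_n i : #|[pred k | r k i]| < n.
  rewrite -[X in _ < X]card_ord; apply: proper_card; apply/properP; split.
    exact/subsetP.
  by exists i; rewrite ?inE ?r_irr.
have rank_inj : injective (fun i => Ordinal (rank_n i)).
  move=> i j /(congr1 val) /= eq_ij; apply/eqP/negPn/negP => /r_total.
  by case/orP => /rank_lt; rewrite eq_ij ltnn.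
exists (perm rank_inj) => i j; rewrite !permE /=.
case r_ij: (r i j); first exact: rank_lt.
case: (eqVneq i j) => [->|/r_total]; first exact: ltnn.
by rewrite r_ij => /rank_lt r_ji; rewrite ltnNge (ltnW r_ji).
Qed.

Lemma perm_order_uniq n (sigma tau : 'S_n) :
  (forall i j, (sigma i < sigma j) = (tau i < tau j)) -> sigma = tau.
Proof.
have card_lt (rho : 'S_n) i : #|[pred j | rho j < rho i]| = rho i.
  rewrite -(card_imset _ (@perm_inj _ rho)).
  have -> : #|[set rho x | x in [pred j | rho j < rho i]]| = #|[pred k : 'I_n | k < rho i]|.
    apply: eq_card => k; rewrite inE; apply/imsetP/idP => [[j + ->]|lt_k]; first by rewrite inE.
    by exists (rho^-1%g k); rewrite ?inE permKV.
  rewrite -sum1_card -(big_ord_widen n (fun=> 1)) ?sum1_card ?card_ord //.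
  exact: ltnW.
move=> eq_lt; apply/permP => i; apply: val_inj; rewrite -[LHS](card_lt sigma i) -[RHS](card_lt tau i).
by apply: eq_card => j; rewrite !inE eq_lt.
Qed.

Definition compatible n (sigma : 'S_n) (w : seq nat) : bool :=
  [forall s in Des sigma, nth 0 w s < nth 0 w s.+1].

Lemma compatibleP n (sigma : 'S_n) w :
  reflect (forall s, s.+1 < n -> nth 0 (oneline sigma) s.+1 < nth 0 (oneline sigma) s ->
             nth 0 w s < nth 0 w s.+1)
          (compatible sigma w).
Proof.
apply: (iffP forall_inP) => [H s lt_s desc|H s]; last first.
  by rewrite mem_Des => desc; apply: H => //; case: s {desc} => s /=; lia.
have lt_s' : s < n.-1 by lia.
by apply: (H (Ordinal lt_s')); rewrite mem_Des.
Qed.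

Lemma perm_sort_mset (m : {mset nat}) : perm_eq (sort leq m) m.
Proof. exact/permPl/perm_sort. Qed.

Lemma fundamental_coef n (S : {set 'I_n.-1}) m :
  fundamental S m = Posz ((size m == n) &&
    [forall s in S, nth 0 (sort leq m) s < nth 0 (sort leq m) s.+1]).
Proof.
rewrite /fundamental /word_series; congr Posz.
set a := fun w : seq nat => _; have a_sort w : w \in permutations m -> a w ->
    w = sort leq m.
  rewrite mem_permutations => perm_w /and3P[_ w_sorted _].
  apply: (sorted_eq leq_trans anti_leq) => //; first exact: sort_sorted leq_total _.
  by rewrite (perm_trans perm_w) // perm_sym perm_sort_mset.
have sort_in : sort leq m \in permutations m by rewrite mem_permutations perm_sort_mset.
have -> : count a (permutations m) = a (sort leq m) * count_mem (sort leq m) (permutations m).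
  rewrite -sum1_count -sum1_count big_distrr /= big_seq_cond [RHS]big_seq_cond.
  rewrite big_mkcondr [RHS]big_mkcondr /=; apply: eq_bigr => w w_in.
  case: eqVneq => [->|ne_w]; first by case: (a _).
  by case: ifP => // /(a_sort _ w_in) eq_w; rewrite eq_w eqxx in ne_w.
rewrite (count_uniq_mem _ (permutations_uniq _)) sort_in muln1 /a.
by rewrite (perm_size (perm_sort_mset m)) (sort_sorted leq_total) /=.
Qed.

Lemma Q_coef n k (Pi : {set 'S_k}) m :
  Q n Pi m = Posz (if size m == n then
    #|[pred sigma : 'S_n | avoids Pi sigma & compatible sigma (sort leq m)]| else 0).
Proof.
rewrite /Q; under eq_bigr do rewrite fundamental_coef.
case: eqP => _ /=; last by rewrite big1.
rewrite -sum1_card -[RHS]natz natr_sum [RHS]big_mkcondr /=.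
by apply: eq_bigr => sigma _; rewrite /compatible; case: ifP.
Qed.

(** * Patterns of length 3 and standardization *)

Definition std3 (x y z : nat) : seq nat :=
  if x < y then if y < z then w123 else if x < z then w132 else w231
  else if x < z then w213 else if y < z then w312 else w321.

Lemma std3_lt x y z a b : x != y -> x != z -> y != z -> a < 3 -> b < 3 ->
  (nth 0 (std3 x y z) a < nth 0 (std3 x y z) b) =
  (nth 0 [:: x; y; z] a < nth 0 [:: x; y; z] b).
Proof.
rewrite /std3 => ne_xy ne_xz ne_yz.
by case: a => [|[|[|a]]] // _; case: b => [|[|[|b]]] // _;
   case: (ltnP x y) => ?; case: (ltnP y z) => ?; case: (ltnP x z) => ?; rewrite /=; lia.
Qed.

Lemma eq_std3 x y z x' y' z' :
    (x < y) = (x' < y') -> (x < z) = (x' < z') -> (y < z) = (y' < z') ->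
  std3 x y z = std3 x' y' z'.
Proof. by rewrite /std3 => -> -> ->. Qed.

Lemma std3_oneline (pi : 'S_3) :
  let v := oneline pi in oneline pi = std3 (nth 0 v 0) (nth 0 v 1) (nth 0 v 2).
Proof.
move=> v; have sz_v : size v = 3 := size_oneline pi.
have v_inj i j : i < 3 -> j < 3 -> nth 0 v i = nth 0 v j -> i = j by apply: oneline_nth_inj.
have v_bnd i : i < 3 -> 0 < nth 0 v i <= 3.
  by move=> lt_i; rewrite -[i]/(val (Ordinal lt_i)) nth_oneline /=.
have := v_inj 0 1 isT isT; have := v_inj 0 2 isT isT; have := v_inj 1 2 isT isT.
move: (v_bnd 0 isT) (v_bnd 1 isT) (v_bnd 2 isT); rewrite -/v {v_inj v_bnd}.
case: v sz_v => [|x [|y [|z []]]] //= _.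
by move: x y z => [|[|[|[|x]]]] [|[|[|[|y]]]] [|[|[|[|z]]]] //= _ _ _;
   do 3![by move/(_ erefl) | move=> _].
Qed.

Lemma containsP n (sigma : 'S_n) (pi : 'S_3) (f := nth 0 (oneline sigma)) :
  contains sigma pi <->
  exists i j k, i < j < k /\ k < n /\ std3 (f i) (f j) (f k) = oneline pi.
Proof.
have f_neq i j : i < j -> j < n -> f i != f j.
  move=> lt_ij lt_j; apply/eqP => /oneline_nth_inj; rewrite (ltn_trans lt_ij) // => /(_ isT lt_j).
  by move=> eq_ij; rewrite eq_ij ltnn in lt_ij.
split=> [/existsP[g /andP[/forallP g_mono /forallP g_iso]]|].
  pose o (a : nat) (lt_a : a < 3) := g (Ordinal lt_a).
  exists (o 0 isT), (o 1 isT), (o 2 isT).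
  have mono a b lt_a lt_b : a < b -> o a lt_a < o b lt_b.
    exact: (implyP (forallP (g_mono (Ordinal lt_a)) (Ordinal lt_b))).
  rewrite !mono // ltn_ord; do 2!split=> //; rewrite std3_oneline.
  have iso a b lt_a lt_b : (f (o a lt_a) < f (o b lt_b)) =
      (nth 0 (oneline pi) a < nth 0 (oneline pi) b).
    rewrite /f !nth_oneline ltnS.
    rewrite -[a in RHS]/(val (Ordinal lt_a)) -[b in RHS]/(val (Ordinal lt_b)) !nth_oneline.
    by rewrite (eqP (forallP (g_iso (Ordinal lt_a)) (Ordinal lt_b))).
  exact: eq_std3.
case=> i [j [k [/andP[lt_ij lt_jk] [lt_k eq_pi]]]].
have lt_j := ltn_trans lt_jk lt_k; have lt_i := ltn_trans lt_ij lt_j.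
pose s := [:: Ordinal lt_i; Ordinal lt_j; Ordinal lt_k].
apply/existsP; exists [ffun a : 'I_3 => nth (Ordinal lt_i) s a].
apply/andP; split; apply/forallP => a; apply/forallP => b; rewrite !ffunE.
  by apply/implyP; case: a b => [[|[|[|a]]] //= _] [[|[|[|b]]] //= _] _; lia.
rewrite -[X in _ == X]ltnS -!nth_oneline -eq_pi std3_lt ?f_neq ?(ltn_trans lt_ij lt_jk) //.
rewrite -[X in X == _]ltnS -!nth_oneline -/f.
by case: a b => [[|[|[|a]]] //= _] [[|[|[|b]]] //= _].
Qed.

Lemma avoidsP n (sigma : 'S_n) (L : seq (seq nat)) (f := nth 0 (oneline sigma)) :
  avoids (patterns L) sigma <->
  forall i j k, i < j -> j < k -> k < n -> std3 (f i) (f j) (f k) \notin L.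
Proof.
split=> [/forall_inP av i j k lt_ij lt_jk lt_k|H].
  apply/negP => inL.
  have lt_j := ltn_trans lt_jk lt_k; have lt_i := ltn_trans lt_ij lt_j.
  pose t (a : 'I_3) := nth 0 [:: i; j; k] a.
  have t_inj (a b : 'I_3) : a != b -> f (t a) != f (t b).
    move=> ne_ab; apply/eqP => /oneline_nth_inj; rewrite /t.
    have lt3 (c : 'I_3) : nth 0 [:: i; j; k] c < n by case: c => [[|[|[|c]]]].
    move/(_ (lt3 a) (lt3 b)); move: ne_ab; rewrite -(inj_eq val_inj).
    by case: a b => [[|[|[|a]]] //= _] [[|[|[|b]]] //= _]; lia.
  have [||a b ne_ab|pi pi_lt] := @perm_of_order 3 (fun a b => f (t a) < f (t b)).
  - by move=> a; apply: ltnn.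
  - by move=> b a c; apply: ltn_trans.
  - by move: (t_inj a b ne_ab); rewrite neq_ltn.
  have eq_pi : std3 (f i) (f j) (f k) = oneline pi.
    have pi_lt' a b (lt_a : a < 3) (lt_b : b < 3) :
        (f (nth 0 [:: i; j; k] a) < f (nth 0 [:: i; j; k] b)) =
        (nth 0 (oneline pi) a < nth 0 (oneline pi) b).
      rewrite -[a in RHS]/(val (Ordinal lt_a)) -[b in RHS]/(val (Ordinal lt_b)) !nth_oneline ltnS.
      by rewrite pi_lt.
    rewrite std3_oneline; apply: eq_std3.
    + exact: (pi_lt' 0 1).
    + exact: (pi_lt' 0 2).
    + exact: (pi_lt' 1 2).
  have := av pi; rewrite inE -eq_pi => /(_ inL); case/negP; apply/containsP.
  by exists i, j, k; rewrite lt_ij.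
apply/forall_inP => pi; rewrite inE => inL; apply/negP => /containsP.
by case=> i [j [k [/andP[lt_ij lt_jk] [lt_k eq_pi]]]]; have := H i j k lt_ij lt_jk lt_k; rewrite eq_pi inL.
Qed.

Lemma ltn_chain (f : nat -> nat) i j :
  i < j -> (forall s, i <= s -> s < j -> f s < f s.+1) -> f i < f j.
Proof.
elim: j => // j IH; rewrite ltnS leq_eqVlt => /predU1P[->|lt_ij] f_inc; first exact: f_inc.
apply: ltn_trans (f_inc j (ltnW lt_ij) (ltnSn j)).
by apply: IH => // s le_is lt_sj; apply: f_inc => //; apply: ltnW.
Qed.

(** The order of positions defining the standardization of [u]: by letter, ties being broken from
    left to right. *)
Definition standard_order (u : seq nat) : rel nat := fun p q =>
  (nth 0 u p < nth 0 u q) || (nth 0 u p == nth 0 u q) && (p < q).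

(** The letter in place [s] of [w] is moved to place [sigma s]. For sorted [w] compatible with
    [sigma], the standardization of the result is the inverse of [sigma]. *)
Definition word_of n (sigma : 'S_n) (w : seq nat) : seq nat :=
  [seq nth 0 w (sigma^-1%g i) | i <- enum 'I_n].

Lemma nth_word_of n (sigma : 'S_n) w (p : 'I_n) :
  nth 0 (word_of sigma w) p = nth 0 w (sigma^-1%g p).
Proof. by rewrite (nth_map p) ?size_enum_ord // nth_ord_enum. Qed.

Lemma perm_word_of n (sigma : 'S_n) w : size w = n -> perm_eq (word_of sigma w) w.
Proof.
move=> sz_w; have {2}-> : w = [seq nth 0 w i | i <- [seq val i | i <- enum 'I_n]].
  by rewrite val_enum_ord -sz_w -/(mkseq _ _) mkseq_nth.
rewrite -map_comp /word_of (map_comp (fun i : 'I_n => nth 0 w i)) -[X in perm_eq _ X]/(map _ _).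
apply: (perm_map (fun i : 'I_n => nth 0 w i)); apply: uniq_perm; rewrite ?enum_uniq //.
  by rewrite (map_inj_uniq perm_inj) enum_uniq.
move=> i; rewrite mem_enum inE; apply/mapP; exists (sigma i); rewrite ?mem_enum ?permK //.
Qed.

(** Compatibility forces a strict increase of [w] at each descent, so [sigma] increases along every
    run of equal letters of [w]. This is the left-to-right rule for ties. *)
Lemma compatible_standard n (sigma : 'S_n) w (p q : 'I_n) :
    size w = n -> sorted leq w -> compatible sigma w ->
  (sigma^-1%g p < sigma^-1%g q) = standard_order (word_of sigma w) p q.
Proof.
move=> sz_w /sorted_leq_nthP w_le /compatibleP compat.
rewrite /standard_order !nth_word_of.
have lt_case i j : i < j -> j < n -> nth 0 w i < nth 0 w j \/
    nth 0 w i = nth 0 w j /\ nth 0 (oneline sigma) i < nth 0 (oneline sigma) j.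
  move=> lt_ij lt_j; have := w_le i j (ltnW lt_ij); rewrite sz_w => /(_ lt_j).
  rewrite leq_eqVlt => /predU1P[eq_w|]; [right; split=> // | by left].
  apply: ltn_chain => // s le_is lt_sj; rewrite ltn_neqAle; apply/andP; split.
    by apply/eqP => /oneline_nth_inj; lia.
  rewrite leqNgt; apply/negP => /compat; have := w_le i s le_is; have := w_le s.+1 j lt_sj.
  by rewrite sz_w; lia.
have pE (x : 'I_n) : (x : nat).+1 = nth 0 (oneline sigma) (sigma^-1%g x).
  by rewrite nth_oneline permKV.
case: ltngtP (lt_case (sigma^-1%g p) (sigma^-1%g q)) (lt_case (sigma^-1%g q) (sigma^-1%g p)).
- move=> lt_pq /(_ isT (ltn_ord _)) + _; rewrite -!pE; case=> [->//|[-> lt]].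
  by rewrite eqxx orbC /=; move: lt; rewrite ltnS => ->.
- move=> lt_qp _ /(_ isT (ltn_ord _)); rewrite -!pE; case=> [lt|[-> lt]].
    by rewrite ltnNge (ltnW lt) /= (gtn_eqF lt).
  by rewrite ltnn eqxx /=; move: lt; rewrite ltnS => /ltnW; rewrite leqNgt => /negbTE ->.
- by move=> /val_inj/perm_inj -> _ _; rewrite !ltnn andbF.
Qed.

Lemma standard_orderP n (u : seq nat) :
  exists tau : 'S_n, forall p q, (tau p < tau q) = standard_order u p q.
Proof.
apply: perm_of_order.
- by move=> p; rewrite /standard_order !ltnn andbF.
- by move=> q p r; rewrite /standard_order; lia.
- by move=> p q; rewrite -(inj_eq val_inj) /standard_order /=; lia.
Qed.

Lemma compatible_of_standard n (sigma : 'S_n) s u :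
    size s = n -> perm_eq u s ->
    (forall p q, (sigma^-1%g p < sigma^-1%g q) = standard_order u p q) ->
  compatible sigma (sort leq s) /\ word_of sigma (sort leq s) = u.
Proof.
move=> sz_s perm_u std; set w := sort leq s.
have sz_u : size u = n by rewrite (perm_size perm_u).
have sz_w : size w = n by rewrite size_sort.
have w_sorted : sorted leq w := sort_sorted leq_total s.
have uw : word_of sigma^-1%g u = w.
  apply: (sorted_eq leq_trans anti_leq) => //.
    apply/(sortedP 0) => i; rewrite size_map size_enum_ord => lt_i.
    pose a := Ordinal (ltnW lt_i); pose b := Ordinal lt_i.
    rewrite -[i.+1]/(val b) -[i]/(val a) !nth_word_of invgK.
    have := std (sigma a) (sigma b); rewrite !permK /= ltnSn /standard_order; lia.
  rewrite (perm_trans (perm_word_of _ _)) // (perm_trans perm_u) //.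
  by rewrite perm_sym; apply/permPl/perm_sort.
have wE (a : 'I_n) : nth 0 w a = nth 0 u (sigma a) by rewrite -uw nth_word_of invgK.
split.
  apply/compatibleP => i lt_i; pose a := Ordinal (ltnW lt_i); pose b := Ordinal lt_i.
  rewrite -[i.+1]/(val b) -[i]/(val a) !nth_oneline !wE.
  have := std (sigma a) (sigma b); rewrite !permK /= ltnSn /standard_order; lia.
apply: (@eq_from_nth _ 0); first by rewrite size_map size_enum_ord sz_u.
rewrite size_map size_enum_ord => i lt_i; rewrite -[i]/(val (Ordinal lt_i)).
by rewrite nth_word_of wE permKV.
Qed.

(** The map from [sigma] to [word_of sigma w] is a bijection from compatible permutations onto
    rearrangements of [s]; its inverse standardizes the word and inverts the permutation. *)
Lemma card_compatible n s (A : pred 'S_n) (B : pred (seq nat)) : size s = n ->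
    (forall (sigma : 'S_n) u, size u = n ->
       (forall p q, (sigma^-1%g p < sigma^-1%g q) = standard_order u p q) ->
       A sigma = B u) ->
  #|[pred sigma : 'S_n | A sigma & compatible sigma (sort leq s)]| =
  count B (permutations s).
Proof.
move=> sz_s AB; set w := sort leq s.
have sz_w : size w = n by rewrite size_sort.
have w_sorted : sorted leq w := sort_sorted leq_total s.
have perm_w : perm_eq w s by apply/permPl/perm_sort.
have std (sigma : 'S_n) : compatible sigma w -> forall p q,
    (sigma^-1%g p < sigma^-1%g q) = standard_order (word_of sigma w) p q.
  by move=> compat p q; apply: compatible_standard.
have sz_word (sigma : 'S_n) : size (word_of sigma w) = n by rewrite size_map size_enum_ord.
rewrite -size_filter cardE -(size_map (fun sigma => word_of sigma w)).
apply/perm_size/uniq_perm.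
- rewrite map_inj_in_uniq ?enum_uniq // => sigma tau.
  rewrite !mem_enum !inE => /andP[_ /std std_s] /andP[_ /std std_t] eq_w.
  apply: invg_inj; apply: perm_order_uniq => p q.
  by rewrite std_s std_t eq_w.
- by rewrite filter_uniq ?permutations_uniq.
move=> u; rewrite mem_filter mem_permutations; apply/mapP/andP => [[sigma]|[Bu perm_u]].
  rewrite mem_enum inE => /andP[As /std std_s] ->; split.
    by rewrite -(AB sigma).
  by rewrite (perm_trans (perm_word_of _ _)).
have [tau std_t] := standard_orderP n u.
have std_s p q : ((tau^-1^-1)%g p < (tau^-1^-1)%g q) = standard_order u p q by rewrite invgK.
have [compat eq_u] := compatible_of_standard sz_s perm_u std_s.
exists tau^-1%g; last by rewrite eq_u.
by rewrite mem_enum inE compat (AB _ u) ?Bu // (perm_size perm_u).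
Qed.

(** * The sets {}, {123} and {321} *)

Lemma schur_nonneg_expansion n (f : series) (c : n.-tuple 'I_n.+1 -> nat) :
    (forall m, f m = Posz (\sum_(la : n.-tuple 'I_n.+1 | is_partition la)
                             c la * count (semistandard (parts la)) (permutations m))) ->
  schur_nonneg n f.
Proof.
move=> f_exp; split.
  move=> g g_bij m; rewrite !f_exp; congr Posz; apply: eq_bigr => la la_part.
  congr (_ * _); apply: count_semistandard_rename la_part g_bij _.
  exact: perm_eq_seq_mset.
exists (fun la => Posz (c la)); split=> // m; rewrite f_exp -[LHS]natz natr_sum.
by apply: eq_bigr => la _; rewrite natz PoszM.
Qed.

Lemma count_permutations_rev (a : pred (seq nat)) (s : seq nat) :
  count (fun u => a (rev u)) (permutations s) = count a (permutations s).
Proof.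
rewrite -(count_map rev).
suff /seq.permP-> : perm_eq [seq rev u | u <- permutations s] (permutations s) by [].
apply: uniq_perm; rewrite ?permutations_uniq //.
  by rewrite (map_inj_uniq (can_inj revK)) permutations_uniq.
move=> u; rewrite mem_permutations; apply/mapP/idP => [[v]|perm_u].
  by rewrite mem_permutations => perm_v ->; rewrite (perm_trans _ perm_v) // perm_rev.
by exists (rev u); rewrite ?revK // mem_permutations (perm_trans _ perm_u) // perm_rev.
Qed.

(** Insertion runs from the right, so [rev u] inserts [u] from left to right. Reversal permutes the
    rearrangements of a word and leaves the counts unchanged. *)
Lemma schur_nonneg_Q_rsk n k (Pi : {set 'S_k}) (P : pred (seq nat)) :
    (forall (sigma : 'S_n) u, size u = n ->
       (forall p q, (sigma^-1%g p < sigma^-1%g q) = standard_order u p q) ->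
       avoids Pi sigma = P (rsk n (rev u)).2) ->
  schur_nonneg n (Q n Pi).
Proof.
move=> avP; apply: (@schur_nonneg_expansion _ _ (nb_recordings P)) => m.
rewrite Q_coef; congr Posz; case: eqP => [sz_m|/eqP ne_m]; last first.
  rewrite big1 // => la /andP[_ /eqP la_sum].
  by rewrite count_semistandard_neq ?muln0 // la_sum.
rewrite -count_rsk // -count_permutations_rev.
exact: card_compatible.
Qed.

Lemma subseq_consP (a : nat) (s u : seq nat) :
  subseq (a :: s) u <-> exists p, [/\ p < size u, nth 0 u p = a & subseq s (drop p.+1 u)].
Proof.
elim: u => [|b u IH]; first by split=> // -[p []].
rewrite [subseq _ _]/=; split.
  case: eqP => [->|_ /IH[p [lt_p eq_p sub_p]]]; last by exists p.+1.
  by exists 0; rewrite /= drop0.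
case=> [[|p] [lt_p /= eq_p sub_p]]; first by move: sub_p; rewrite eq_p eqxx /= drop0.
have sub_as : subseq (a :: s) u by apply/IH; exists p.
by case: eqP => // _; apply: subseq_trans sub_as; apply: subseq_cons.
Qed.

Lemma subseq3P (R : nat -> nat -> nat -> Prop) (u : seq nat) :
  (exists a b c, R a b c /\ subseq [:: a; b; c] u) <->
  exists p q r, [/\ p < q, q < r, r < size u & R (nth 0 u p) (nth 0 u q) (nth 0 u r)].
Proof.
split=> [[a [b [c [Rabc /subseq_consP[p [lt_p eq_p]]]]]]|[p [q [r [lt_pq lt_qr lt_r Ru]]]]].
  case/subseq_consP=> q [lt_q eq_q] /subseq_consP[r [lt_r eq_r _]].
  move: lt_q eq_q lt_r eq_r; rewrite !size_drop !nth_drop => lt_q eq_q lt_r eq_r.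
  exists p, (p.+1 + q), (p.+1 + (q.+1 + r)); split; try lia.
  by rewrite eq_p eq_q eq_r.
exists (nth 0 u p), (nth 0 u q), (nth 0 u r); split=> //.
apply/subseq_consP; exists p; split=> //; first by lia.
apply/subseq_consP; exists (q - p.+1); rewrite size_drop nth_drop subnKC //; split=> //.
  by lia.
apply/subseq_consP; exists (r - q.+1); rewrite !size_drop !nth_drop sub0seq.
by split=> //; [lia | congr nth; lia].
Qed.

Section Standardization.

Variables (n : nat) (sigma : 'S_n) (u : seq nat).
Hypothesis sz_u : size u = n.
Hypothesis std : forall p q, (sigma^-1%g p < sigma^-1%g q) = standard_order u p q.

Lemma standard_order_lt (p q : 'I_n) :
  p < q -> (sigma^-1%g p < sigma^-1%g q) = (nth 0 u p <= nth 0 u q).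
Proof. by rewrite std /standard_order; lia. Qed.

(** The positions in [u] are the values of [sigma], so a decreasing triple of [sigma] gives one of
    its inverse, with places and values exchanged. As ties are broken from left to right, descents
    become strict inequalities of letters here, and ascents become weak ones in
    [inc_triple_word]. *)
Lemma dec_triple_word :
  (exists i j k : 'I_n, [/\ i < j, j < k, sigma j < sigma i & sigma k < sigma j]) <->
  exists p q r, [/\ p < q, q < r, r < size u &
                    nth 0 u r < nth 0 u q /\ nth 0 u q < nth 0 u p].
Proof.
split=> [[i [j [k [lt_ij lt_jk lt_ji lt_kj]]]]|[p [q [r [lt_pq lt_qr lt_r [u_rq u_qp]]]]]].
  exists (sigma k), (sigma j), (sigma i); rewrite sz_u; split=> //.
  have := standard_order_lt lt_kj; have := standard_order_lt lt_ji.
  by rewrite !permK; lia.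
rewrite sz_u in lt_r; have lt_q := ltn_trans lt_qr lt_r; have lt_p := ltn_trans lt_pq lt_q.
exists (sigma^-1%g (Ordinal lt_r)), (sigma^-1%g (Ordinal lt_q)), (sigma^-1%g (Ordinal lt_p)).
by rewrite !permKV !std /standard_order /=; split=> //; lia.
Qed.

Lemma inc_triple_word :
  (exists i j k : 'I_n, [/\ i < j, j < k, sigma i < sigma j & sigma j < sigma k]) <->
  exists p q r, [/\ p < q, q < r, r < size u &
                    nth 0 u p <= nth 0 u q /\ nth 0 u q <= nth 0 u r].
Proof.
split=> [[i [j [k [lt_ij lt_jk s_ij s_jk]]]]|[p [q [r [lt_pq lt_qr lt_r [u_pq u_qr]]]]]].
  exists (sigma i), (sigma j), (sigma k); rewrite sz_u; split=> //.
  have := standard_order_lt s_ij; have := standard_order_lt s_jk.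
  by rewrite !permK; lia.
rewrite sz_u in lt_r; have lt_q := ltn_trans lt_qr lt_r; have lt_p := ltn_trans lt_pq lt_q.
exists (sigma^-1%g (Ordinal lt_p)), (sigma^-1%g (Ordinal lt_q)), (sigma^-1%g (Ordinal lt_r)).
by rewrite !permKV !std /standard_order /=; split=> //; lia.
Qed.

End Standardization.

Lemma avoids321P n (sigma : 'S_n) :
  avoids (patterns [:: w321]) sigma <->
  ~ exists i j k : 'I_n, [/\ i < j, j < k, sigma j < sigma i & sigma k < sigma j].
Proof.
rewrite avoidsP; split=> [av [i [j [k [lt_ij lt_jk s_ji s_kj]]]]|no_dec i j k lt_ij lt_jk lt_k].
  have := av i j k lt_ij lt_jk (ltn_ord k); rewrite !nth_oneline /std3.
  have -> : (sigma i).+1 < (sigma j).+1 = false by lia.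
  have -> : (sigma i).+1 < (sigma k).+1 = false by lia.
  by have -> : (sigma j).+1 < (sigma k).+1 = false by lia.
have lt_j := ltn_trans lt_jk lt_k; have lt_i := ltn_trans lt_ij lt_j.
apply/negP => std; apply: no_dec.
exists (Ordinal lt_i), (Ordinal lt_j), (Ordinal lt_k).
have neq a b : a < b -> b < n -> nth 0 (oneline sigma) a != nth 0 (oneline sigma) b.
  by move=> lt_ab lt_b; apply/eqP => /oneline_nth_inj; lia.
rewrite -[_ < sigma (Ordinal lt_i)]ltnS -[_ < sigma (Ordinal lt_j)]ltnS -!nth_oneline /=.
move: std (neq i j lt_ij lt_j) (neq j k lt_jk lt_k); rewrite /std3 inE.
set f := nth 0 (oneline sigma).
by case: (ltnP (f i) (f j)) => ?; case: (ltnP (f j) (f k)) => ?;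
   case: (ltnP (f i) (f k)) => ? // _ ? ?; split=> //; lia.
Qed.

Lemma avoids123P n (sigma : 'S_n) :
  avoids (patterns [:: w123]) sigma <->
  ~ exists i j k : 'I_n, [/\ i < j, j < k, sigma i < sigma j & sigma j < sigma k].
Proof.
rewrite avoidsP; split=> [av [i [j [k [lt_ij lt_jk s_ij s_jk]]]]|no_inc i j k lt_ij lt_jk lt_k].
  have := av i j k lt_ij lt_jk (ltn_ord k); rewrite !nth_oneline /std3.
  have -> : (sigma i).+1 < (sigma j).+1 by lia.
  by have -> : (sigma j).+1 < (sigma k).+1 by lia.
have lt_j := ltn_trans lt_jk lt_k; have lt_i := ltn_trans lt_ij lt_j.
apply/negP => std; apply: no_inc.
exists (Ordinal lt_i), (Ordinal lt_j), (Ordinal lt_k).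
rewrite -[sigma (Ordinal lt_i) < _]ltnS -[sigma (Ordinal lt_j) < _]ltnS -!nth_oneline /=.
move: std; rewrite /std3 inE.
set f := nth 0 (oneline sigma).
by case: (ltnP (f i) (f j)) => ?; case: (ltnP (f j) (f k)) => ?;
   case: (ltnP (f i) (f k)) => ? // _; split=> //; lia.
Qed.

Lemma nth_content_rsk n v i : size v = n ->
  nth 0 (content n (rsk n v).2) i = size (nth [::] (rsk n v).1 i).
Proof.
move=> sz_v; have [_ <- _ _ _] := @rskP n v (eq_leq sz_v).
have [lt_i|le_i] := ltnP i (size (rsk n v).1); first by rewrite (nth_map [::]).
by rewrite !nth_default // size_map.
Qed.

Lemma schur_nonneg_Q_all n : schur_nonneg n (Q n (set0 : {set 'S_3})).
Proof.
apply: (@schur_nonneg_Q_rsk _ _ _ predT) => sigma u _ _.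
by apply/forall_inP => pi; rewrite inE.
Qed.

Lemma schur_nonneg_Q123 n : schur_nonneg n (Q n (patterns [:: w123])).
Proof.
apply: (@schur_nonneg_Q_rsk _ _ _ (fun r => nth 0 (content n r) 0 <= 2)).
move=> sigma u sz_u std; rewrite nth_content_rsk ?size_rev //.
suff av_iff : avoids (patterns [:: w123]) sigma <->
    size (nth [::] (rsk n (rev u)).1 0) <= 2 by apply/idP/idP => /av_iff.
rewrite avoids123P (inc_triple_word sz_u std) -(subseq3P (fun a b c => a <= b /\ b <= c)).
have -> : size (nth [::] (rsk n (rev u)).1 0) = size (first_row (rev u)).
  case: n sigma sz_u {std} => [|N] sigma sz_u; last by rewrite rsk_rows.
  by rewrite (size0nil sz_u).
rewrite first_row_size; split=> no_triple.
  case=> [[|c [|b [|a [|? ?]]]]] [sub_s s_sorted] //= _.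
  case/and3P: s_sorted => le_bc le_ab _.
  apply: no_triple; exists a, b, c; split=> //.
  by rewrite -subseq_rev.
case=> a [b [c [[le_ab le_bc] sub_abc]]]; apply: no_triple.
exists [:: c; b; a]; split=> //; last by rewrite /= le_bc le_ab.
by rewrite -subseq_rev revK.
Qed.

Lemma schur_nonneg_Q321 n : schur_nonneg n (Q n (patterns [:: w321])).
Proof.
apply: (@schur_nonneg_Q_rsk _ _ _ (fun r => nth 0 (content n r) 2 == 0)).
move=> sigma u sz_u std; rewrite nth_content_rsk ?size_rev //.
suff av_iff : avoids (patterns [:: w321]) sigma <-> nth [::] (rsk n (rev u)).1 2 = [::].
  by apply/idP/idP => [/av_iff -> //|/eqP/size0nil/av_iff].
rewrite avoids321P (dec_triple_word sz_u std) -(subseq3P (fun a b c => c < b /\ b < a)).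
have -> : nth [::] (rsk n (rev u)).1 2 = [::] <-> ~ has_triple (rev u).
  (* For [n < 3] there is no third row: [nth] returns its default, the empty row, and a word this
     short has no triple. *)
  have [lt_n|] := ltnP n 3; last first.
    by case: (n) => [|[|[|N]]] // _; apply: third_row_nil.
  rewrite nth_default ?size_rsk ?size_rev ?sz_u //; split=> // _ [a [b [c [_ /size_subseq]]]].
  by rewrite size_rev sz_u leqNgt lt_n.
split=> no_triple.
  case=> a [b [c [/andP[lt_cb lt_ba] sub_cba]]]; apply: no_triple.
  by exists a, b, c; rewrite -subseq_rev.
case=> a [b [c [[lt_cb lt_ba] sub_abc]]]; apply: no_triple.
by exists a, b, c; rewrite lt_cb -subseq_rev revK.
Qed.

(** * Hook Schur functions *)

Definition hook (n k : nat) : seq nat :=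
  mkseq (fun i => if i == 0 then n - k else (i <= k : nat)) n.

Lemma hookS n k : k <= n ->
  hook n.+1 k = n.+1 - k :: nseq k 1 ++ nseq (n - k) 0.
Proof.
move=> le_kn; apply: (@eq_from_nth _ 0).
  by rewrite size_mkseq /= size_cat !size_nseq subnKC.
rewrite size_mkseq => -[|i] lt_i; rewrite nth_mkseq //=.
rewrite nth_cat size_nseq !nth_nseq if_same; case: ltnP => [//|]; by [].
Qed.

Lemma sumn_hook n k : k <= n.-1 -> sumn (hook n k) = n.
Proof.
case: n => [//|n] le_kn; rewrite hookS //= sumn_cat !sumn_nseq; lia.
Qed.

Lemma sorted_hook n k : k <= n.-1 -> sorted geq (hook n k).
Proof.
case: n => [//|n] le_kn; rewrite hookS //.
have path0 x b : path geq x (nseq b 0) by elim: b x => //= b IH x; rewrite IH.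
have path1 j b : path geq 1 (nseq j 1 ++ nseq b 0) by elim: j => [|j IH] //=; exact: path0.
rewrite /sorted; case: k le_kn => [|k] le_kn /=; first exact: path0.
by rewrite path1 andbT; lia.
Qed.

(** The row is read before the leg, so the leg is a suffix of the word, while the corner it hangs
    from is the first letter. *)
Lemma semistandard_hook n k w : k <= n -> size w = n.+1 ->
  semistandard (hook n.+1 k) w =
  sorted leq (take (n.+1 - k) w) && path ltn (head 0 w) (drop (n.+1 - k) w).
Proof.
move=> le_kn sz_w; rewrite /semistandard sumn_hook // sz_w eqxx hookS //=.
set r := take _ w; set c := drop _ w.
have sz_c : size c = k by rewrite size_drop sz_w; lia.
have sz_r : size r = (n - k).+1 by rewrite size_take sz_w; case: ltnP; lia.
have -> : reshape (nseq k 1 ++ nseq (n - k) 0) c =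
    [seq [:: x] | x <- c] ++ nseq (n - k) [::].
  rewrite -{1}sz_c; elim: (c) (n - k) => [|x c' IH] b /=; last by rewrite take0 drop0 IH.
  by elim: b => //= b ->.
have -> : all (sorted leq) ([seq [:: x] | x <- c] ++ nseq (n - k) [::]).
  by rewrite all_cat all_nseq orbT andbT; apply/allP => _ /mapP[x _ ->].
rewrite andbT; congr andb.
have -> : head 0 w = head 0 r.
  by rewrite /r; case: (w) sz_w => // x w' _; rewrite subSn.
case: r sz_r => [//|x r] _ /=; elim: c x r {sz_c} => [|y c IH] x r /=.
  by case: (n - k) => //= b; elim: b => //= b ->.
by rewrite IH; case: r => [|? ?]; rewrite andbT.
Qed.

(** For a sorted word [h :: t], a letter of [t] may be selected only where it exceeds its
    predecessor; bit [s] thus stands for an ascent at position [s] of [h :: t]. *)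
Fixpoint ascent_mask (h : nat) (t : seq nat) (b : bitseq) : bool :=
  if t is x :: t' then
    if b is c :: b' then (c ==> (h < x)) && ascent_mask x t' b' else true
  else true.

Lemma path_ltn_leq h x s : h <= x -> path ltn x s -> path ltn h s.
Proof. by case: s => //= y s le_hx /andP[lt_xy ->]; rewrite (leq_ltn_trans le_hx). Qed.

Lemma path_ascent_mask h t b :
  path leq h t -> ascent_mask h t b -> path ltn h (mask b t).
Proof.
elim: t h b => [|x t IH] h [|[] b] //= /andP[le_hx t_sorted].
  by case/andP=> ->; apply: IH.
by move/IH => /(_ t_sorted); apply: path_ltn_leq.
Qed.

(** At the first difference one mask selects [x], while everything the other selects from there on
    is strictly larger than [x]. *)
Lemma ascent_mask_inj h t b b' : path leq h t ->
    size b = size t -> size b' = size t -> ascent_mask h t b -> ascent_mask h t b' ->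
  mask b t = mask b' t -> b = b'.
Proof.
elim: t h b b' => [|x t IH] h [|c b] [|c' b'] //= /andP[_ t_sorted] [sz_b] [sz_b'].
case/andP=> _ asc /andP[_ asc'].
have path_b := path_ascent_mask t_sorted asc; have path_b' := path_ascent_mask t_sorted asc'.
case: c c' => [] [].
- by case=> /(IH _ _ _ t_sorted sz_b sz_b' asc asc') ->.
- by move=> eq_m; rewrite -eq_m /= ltnn in path_b'.
- by move=> eq_m; rewrite eq_m /= ltnn in path_b.
- by move/(IH _ _ _ t_sorted sz_b sz_b' asc asc') ->.
Qed.

Lemma ascent_mask_exists h t c : path leq h t -> path ltn h c -> subseq c t ->
  exists b, [/\ size b = size t, ascent_mask h t b & mask b t = c].
Proof.
elim: t h c => [|x t IH] h c /=; first by move=> _ _ /eqP ->; exists [::].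
case/andP=> le_hx t_sorted; case: c => [|y c] /=.
  have [b [sz_b asc eq_m]] := IH x [::] t_sorted isT (sub0seq _).
  by exists (false :: b); rewrite /= sz_b.
case/andP=> lt_hy path_c; case: (eqVneq y x) => [eq_yx|ne_yx] sub_c.
  subst y; have [b [sz_b asc eq_m]] := IH x c t_sorted path_c sub_c.
  by exists (true :: b); rewrite /= sz_b lt_hy eq_m.
have lt_xy : x < y.
  have y_in : y \in t by apply: (mem_subseq sub_c); rewrite inE eqxx.
  have := order_path_min leq_trans t_sorted => /allP/(_ y y_in); lia.
have [|b [sz_b asc eq_m]] := IH x (y :: c) t_sorted _ sub_c; first by rewrite /= lt_xy.
by exists (false :: b); rewrite /= sz_b.
Qed.

Lemma perm_mask_negb (b : bitseq) (t : seq nat) :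
  size b = size t -> perm_eq (mask (map negb b) t ++ mask b t) t.
Proof.
elim: t b => [|x t IH] [|[] b] //= [sz_b]; last by rewrite perm_cons IH.
by rewrite -cat1s perm_catCA /= perm_cons IH.
Qed.

Definition set_mask n (S : {set 'I_n}) : bitseq := [seq s \in S | s <- enum 'I_n].

Lemma size_set_mask n (S : {set 'I_n}) : size (set_mask S) = n.
Proof. by rewrite size_map size_enum_ord. Qed.

Lemma nth_set_mask n (S : {set 'I_n}) (s : 'I_n) : nth false (set_mask S) s = (s \in S).
Proof. by rewrite (nth_map s) ?size_enum_ord // nth_ord_enum. Qed.

Lemma count_set_mask n (S : {set 'I_n}) : count id (set_mask S) = #|S|.
Proof. by rewrite count_map cardE -size_filter enumT. Qed.

Lemma set_mask_inj n : injective (@set_mask n).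
Proof. by move=> S S' eq_m; apply/setP => s; rewrite -!nth_set_mask eq_m. Qed.

Lemma set_mask_surj n (b : bitseq) : size b = n -> exists S : {set 'I_n}, set_mask S = b.
Proof.
move=> sz_b; exists [set s : 'I_n | nth false b s].
apply: (@eq_from_nth _ false); rewrite size_set_mask // => i lt_i.
by rewrite -[i]/(val (Ordinal lt_i)) nth_set_mask inE.
Qed.

Lemma ascent_maskP h t b : size b = size t ->
  reflect (forall s, s < size t -> nth false b s -> nth 0 (h :: t) s < nth 0 t s)
          (ascent_mask h t b).
Proof.
elim: t h b => [|x t IH] h [|c b] //=; first by left.
case=> sz_b; apply: (iffP andP) => [[/implyP asc0 /(IH x b sz_b) asc] [|s] //|asc].
  exact: asc.
split; first by apply/implyP; apply: (asc 0).
by apply/(IH x b sz_b) => s; apply: (asc s.+1).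
Qed.

(* A semistandard hook is determined by its leg, a strictly increasing
   selection among the letters other than a minimal one; selecting the leftmost
   copy of each letter puts the legs in bijection with sets of ascents. *)
Lemma count_semistandard_hook n k (s : seq nat) (w := sort leq s) :
    size s = n -> k <= n.-1 ->
  #|[pred S : {set 'I_n.-1} |
      (#|S| == k) && [forall i in S, nth 0 w i < nth 0 w i.+1]]| =
  count (semistandard (hook n k)) (permutations s).
Proof.
case: n => [|n] sz_s /= le_kn.
  move: le_kn; rewrite leqn0 => /eqP ->; rewrite (size0nil sz_s) /=.
  rewrite (_ : #|_| = #|[pred S : {set 'I_0} | true]|); last first.
    apply: eq_card => S; rewrite !inE; have -> : S = set0 by apply/setP => -[].
    by rewrite cards0 /=; apply/forall_inP => i; rewrite inE.
  have -> : #|[pred S : {set 'I_0} | true]| = #|powerset [set: 'I_0]|.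
    by apply: eq_card => S; rewrite !inE subsetT.
  by rewrite card_powerset cardsT card_ord.
have w_sorted : sorted leq w := sort_sorted leq_total s.
have perm_w : perm_eq w s by apply/permPl/perm_sort.
have sz_w : size w = n.+1 by rewrite size_sort.
case w_eq: w sz_w w_sorted perm_w => [//|h t] [sz_t] /= t_sorted perm_w.
have asc_mask (S : {set 'I_n}) :
    [forall i in S, nth 0 (h :: t) i < nth 0 (h :: t) i.+1] = ascent_mask h t (set_mask S).
  apply/forall_inP/ascent_maskP; rewrite ?size_set_mask // => asc i.
    rewrite sz_t => lt_i; rewrite -[i]/(val (Ordinal lt_i)) nth_set_mask => i_in.
    exact: asc _ i_in.
  by move=> i_in; apply: asc; rewrite ?sz_t ?nth_set_mask.
(* The selected letters form the leg; the others, behind the minimal letter [h], form the row. *)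
pose word (b : bitseq) := (h :: mask (map negb b) t) ++ mask b t.
have sz_mask b : size b = n -> count id b = k ->
    size (mask b t) = k /\ size (h :: mask (map negb b) t) = n.+1 - k.
  move=> sz_b cnt; have sz_c : size (mask b t) = k by rewrite size_mask ?sz_t.
  split=> //; have /perm_size := @perm_mask_negb b t (etrans sz_b (esym sz_t)).
  by rewrite size_cat sz_t /= sz_c; lia.
have sz_v v : v \in permutations s -> size v = n.+1.
  by rewrite mem_permutations => /perm_size ->.
rewrite -size_filter cardE -(size_map (fun S => word (set_mask S))).
apply/perm_size/uniq_perm; rewrite ?filter_uniq ?permutations_uniq //.
  rewrite map_inj_in_uniq ?enum_uniq // => S S'; rewrite !mem_enum !inE !asc_mask.
  case/andP=> /eqP cS ascS /andP[/eqP cS' ascS'] eq_word.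
  have [] := sz_mask (set_mask S); rewrite ?size_set_mask ?count_set_mask // => _ szS.
  have [] := sz_mask (set_mask S'); rewrite ?size_set_mask ?count_set_mask // => _ szS'.
  apply: set_mask_inj; apply: (ascent_mask_inj t_sorted) => //; rewrite ?size_set_mask //.
  have := congr1 (drop (n.+1 - k)) eq_word.
  by rewrite /word !drop_size_cat.
move=> v; apply/mapP/idP => [[S + ->]|].
  rewrite mem_enum inE asc_mask => /andP[/eqP cS ascS].
  have [] := sz_mask (set_mask S); rewrite ?size_set_mask ?count_set_mask // => sz_c sz_r.
  have v_in : word (set_mask S) \in permutations s.
    rewrite mem_permutations /word cat_cons; apply: perm_trans perm_w.
    by rewrite perm_cons perm_mask_negb // size_set_mask.
  rewrite mem_filter v_in andbT semistandard_hook ?sz_v //.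
  rewrite /word take_size_cat ?drop_size_cat // path_ascent_mask // andbT.
  by apply: (subseq_sorted leq_trans (s2 := h :: t)) => //=; rewrite eqxx mask_subseq.
rewrite mem_filter => /andP[sem_v v_in]; have szv := sz_v v v_in.
move: sem_v; rewrite semistandard_hook // => /andP[].
set r := take _ v; set c := drop _ v => r_sorted path_c.
have v_cat : v = r ++ c by rewrite cat_take_drop.
have sz_c : size c = k by rewrite size_drop szv; lia.
have perm_v : perm_eq (r ++ c) (h :: t).
  by rewrite -v_cat perm_sym (perm_trans perm_w) // perm_sym -mem_permutations.
case: r r_sorted v_cat perm_v => [|x r] r_sorted v_cat perm_v.
  by move: szv; rewrite v_cat /= sz_c; lia.
rewrite v_cat /= in path_c r_sorted.
(* The corner is minimal in its row and below its leg, hence it is the least letter of the whole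
   word. *)
have eq_xh : x = h.
  have x_min : all (leq x) (r ++ c).
    rewrite all_cat (order_path_min leq_trans r_sorted) /=.
    by apply: sub_all (order_path_min ltn_trans path_c) => y; apply: ltnW.
  have h_min := order_path_min leq_trans t_sorted.
  have h_in : h \in x :: (r ++ c) by rewrite (perm_mem perm_v) inE eqxx.
  have x_in : x \in h :: t by rewrite -(perm_mem perm_v) inE eqxx.
  apply/eqP; rewrite eqn_leq; apply/andP; split.
    by move: h_in; rewrite inE => /predU1P[-> //|/(allP x_min)].
  by move: x_in; rewrite inE => /predU1P[-> //|/(allP h_min)].
subst x; have {}perm_v : perm_eq (r ++ c) t by move: perm_v; rewrite perm_cons.
have c_sorted : sorted leq c.
  by apply: sub_sorted (path_sorted path_c) => y z; apply: ltnW.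
have sub_c : subseq c t.
  have <- : sort leq c = c by apply: sorted_sort c_sorted; apply: leq_trans.
  have <- : sort leq (r ++ c) = t.
    apply: (sorted_eq leq_trans anti_leq); rewrite ?sort_sorted ?(path_sorted t_sorted) //.
      exact: leq_total.
    by rewrite (perm_trans _ perm_v) //; apply/permPl/perm_sort.
  apply: (subseq_sort leq_total leq_trans); exact: suffix_subseq.
have [b [sz_b asc_b eq_c]] := ascent_mask_exists t_sorted path_c sub_c.
have [S S_b] := set_mask_surj (etrans sz_b sz_t).
exists S.
  rewrite mem_enum inE asc_mask S_b asc_b andbT -count_set_mask S_b.
  by rewrite -sz_c -eq_c size_mask.
rewrite S_b /word eq_c v_cat; congr (_ ++ _); congr cons.
apply: (sorted_eq leq_trans anti_leq); first exact: path_sorted r_sorted.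
  apply: (subseq_sorted leq_trans (mask_subseq _ _)); exact: path_sorted t_sorted.
have := perm_trans perm_v; rewrite -(perm_cat2r c) => -> //.
by rewrite -[in X in perm_eq _ X]eq_c perm_sym perm_mask_negb.
Qed.

(** * Sets determined by a comparison rule *)

Lemma schur_nonneg_hooks n k (Pi : {set 'S_k}) (K : pred nat) :
    (forall S, #|[pred sigma : 'S_n | avoids Pi sigma & Des sigma == S]| = K #|S|) ->
  schur_nonneg n (Q n Pi).
Proof.
move=> card_Des.
(* Written as a sum over [j], so that exchanging the summations groups the descent sets by size
   without having to recover [j] from [la]. *)
pose c (la : n.-tuple 'I_n.+1) := \sum_(j < n.-1.+1) (K j && (parts la == hook n j)).
apply: (@schur_nonneg_expansion _ _ c) => m.
rewrite Q_coef; congr Posz; case: eqP => [sz_m|/eqP ne_m]; last first.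
  rewrite big1 // => la /andP[_ /eqP la_sum].
  by rewrite count_semistandard_neq ?muln0 // la_sum.
pose asc (S : {set 'I_n.-1}) :=
  [forall i in S, nth 0 (sort leq m) i < nth 0 (sort leq m) i.+1].
have -> : #|[pred sigma : 'S_n | avoids Pi sigma & compatible sigma (sort leq m)]| =
    \sum_(S : {set 'I_n.-1} | asc S) K #|S|.
  rewrite -sum1_card (partition_big (@Des n) asc) /=; last first.
    by move=> sigma; rewrite inE => /andP[].
  apply: eq_bigr => S asc_S; rewrite -card_Des -sum1_card; apply: eq_bigl => sigma.
  rewrite !inE -andbA; congr andb; case: eqP => [eq_S|_]; last by rewrite andbF.
  by rewrite andbT /compatible eq_S.
rewrite (partition_big (fun S : {set 'I_n.-1} => inord #|S| : 'I_n.-1.+1) predT) //=.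
under [RHS]eq_bigr do rewrite /c big_distrl /=.
rewrite exchange_big /=; apply: eq_bigr => j _.
have le_j : j <= n.-1 by rewrite -ltnS.
have hook_le : all (geq n) (hook n j).
  apply/allP => _ /mapP[i + ->]; rewrite mem_iota => /andP[_ lt_i] /=.
  by case: ifP => _; [exact: leq_subr | case: (i <= j) => /=; lia].
have -> : \sum_(S : {set 'I_n.-1} | asc S && (inord #|S| == j)) K #|S| =
    K j * count (semistandard (hook n j)) (permutations m).
  rewrite -(count_semistandard_hook sz_m le_j) mulnC -sum_nat_const.
  have lt_card (S : {set 'I_n.-1}) : #|S| < n.-1.+1.
    by rewrite ltnS -[X in _ <= X]card_ord max_card.
  have card_eq (S : {set 'I_n.-1}) : (inord #|S| == j) = (#|S| == j).
    by rewrite -(inj_eq val_inj) /= inordK.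
  apply: eq_big => [S|S]; first by rewrite inE card_eq andbC.
  by rewrite card_eq => /andP[_ /eqP ->].
have hookE : parts (padded_tuple n (hook n j)) = hook n j.
  by rewrite parts_padded_tuple ?size_mkseq.
rewrite (bigD1 (padded_tuple n (hook n j))) /=; last first.
  by rewrite /is_partition hookE sorted_hook ?sumn_hook ?eqxx.
rewrite hookE eqxx andbT big1 ?addn0 // => la /andP[_ ne_la].
by rewrite -hookE (inj_eq (@parts_inj n)) (negPf ne_la) andbF.
Qed.

Section PatternOrders.

(* A set of two patterns of length 3 on the list amounts to a rule [f] giving
   the comparison of the outer entries from the two comparisons of neighbours. *)
Variable f : bool -> bool -> bool.
Hypotheses (fA : associative f) (fxx : idempotent_op f).

Definition entry n (sigma : 'S_n) (i : nat) := nth 0 (oneline sigma) i.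

Definition follows_rule n (sigma : 'S_n) : Prop :=
  forall i j k, i < j -> j < k -> k < n ->
    (entry sigma i < entry sigma k) = f (entry sigma i < entry sigma j) (entry sigma j < entry sigma k).

(** Combines the steps [a i] to [a (i + d)], both included. Comparing the entries at [i] and [k]
    involves the steps from [i] to [k - 1], hence the argument [k - i.+1] in [compare]. *)
Fixpoint fold_rule (a : nat -> bool) (i d : nat) : bool :=
  if d is d'.+1 then f (fold_rule a i d') (a (i + d)) else a i.

Definition compare (a : nat -> bool) (i k : nat) : bool := fold_rule a i (k - i.+1).

Lemma compareS a i : compare a i i.+1 = a i.
Proof. by rewrite /compare subnn. Qed.

Lemma compareSr a i k : i < k -> compare a i k.+1 = f (compare a i k) (a k).
Proof.
move=> lt_ik; rewrite /compare subSS -(subSS i k) subSn //=.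
by congr (f _ (a _)); lia.
Qed.

Lemma compare_trans a i j k : i < j -> j < k ->
  compare a i k = f (compare a i j) (compare a j k).
Proof.
move=> lt_ij; elim: k => // k IH; rewrite ltnS leq_eqVlt => /predU1P[<-|lt_jk].
  by rewrite compareSr // compareS.
by rewrite !compareSr ?(ltn_trans lt_ij) // IH // fA.
Qed.

Lemma follows_rule_compare n (sigma : 'S_n) :
  follows_rule sigma <->
  forall i k, i < k -> k < n ->
    (entry sigma i < entry sigma k) = compare (fun s => entry sigma s < entry sigma s.+1) i k.
Proof.
split=> [rule i k lt_ik lt_k|cmp i j k lt_ij lt_jk lt_k].
  elim: k lt_ik lt_k => // k IH; rewrite ltnS leq_eqVlt => /predU1P[<-|lt_ik] lt_k.
    by rewrite compareS.
  by rewrite compareSr // -IH ?(ltnW lt_k) // (rule i k k.+1).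
have lt_j := ltn_trans lt_jk lt_k; rewrite !cmp //; last exact: ltn_trans lt_jk.
exact: compare_trans.
Qed.

Lemma eq_compare a b i k : (forall s, i <= s -> s < k -> a s = b s) -> i < k ->
  compare a i k = compare b i k.
Proof.
move=> eq_ab; elim: k eq_ab => // k IH eq_ab; rewrite ltnS leq_eqVlt => /predU1P[eq_ik|lt_ik].
  by rewrite -eq_ik !compareS eq_ab ?eq_ik.
rewrite !compareSr // IH //; first by rewrite eq_ab // ltnW.
by move=> s le_is lt_sk; apply: eq_ab => //; apply: ltnW.
Qed.

(** The comparisons predicted by [f] form a linear order. By associativity the outer comparison of a
    triple is [f] of the two inner ones, and a cycle would make the inner ones equal to some [c] and
    the outer one different from [c], against [f c c = c]. *)
Lemma follows_rule_exists n (a : nat -> bool) :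
  exists sigma : 'S_n, follows_rule sigma /\
    forall s, s.+1 < n -> (entry sigma s < entry sigma s.+1) = a s.
Proof.
pose r (i k : 'I_n) := if i < k then compare a i k
                       else if k < i then ~~ compare a k i else false.
have [||i k ne_ik|sigma sigma_lt] := @perm_of_order n r.
- by move=> i; rewrite /r ltnn.
- move=> j i k; rewrite /r.
  have tr := compare_trans a.
  case: (ltngtP i j) => [lt_ij|lt_ji|_] //; case: (ltngtP j k) => [lt_jk|lt_kj|_] //.
  + by rewrite (ltn_trans lt_ij lt_jk) (tr _ _ _ lt_ij lt_jk) => -> ->; rewrite fxx.
  + case: (ltngtP i k) => [lt_ik|lt_ki|/val_inj <-].
    * rewrite (tr _ _ _ lt_ik lt_kj); case: (compare a i k) => //.
      by move=> + /negbTE eq_kj; rewrite eq_kj fxx.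
    * move=> ij_true; rewrite (tr _ _ _ lt_ki lt_ij) ij_true; apply: contra => ki_true.
      by rewrite ki_true fxx.
    * by move=> ->.
  + case: (ltngtP i k) => [lt_ik|lt_ki|/val_inj <-].
    * move=> /negbTE ji_false; rewrite (tr _ _ _ lt_ji lt_ik) ji_false.
      by case: (compare a i k) => //; rewrite fxx.
    * move=> ji_false jk_true; apply: contra ji_false => ki_true.
      by rewrite (tr _ _ _ lt_jk lt_ki) jk_true ki_true fxx.
    * by move=> /negbTE ->.
  + have lt_ki := ltn_trans lt_kj lt_ji; rewrite ltnNge (ltnW lt_ki) /= lt_ki.
    rewrite (tr _ _ _ lt_kj lt_ji) => /negbTE -> /negbTE ->; by rewrite fxx.
- rewrite /r; move: ne_ik; rewrite -(inj_eq val_inj) /=.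
  by case: ltngtP => // _ _; case: compare.
have sigma_cmp i k : i < k -> k < n -> (entry sigma i < entry sigma k) = compare a i k.
  move=> lt_ik lt_k; have lt_i := ltn_trans lt_ik lt_k.
  rewrite /entry -[i in LHS]/(val (Ordinal lt_i)) -[k in LHS]/(val (Ordinal lt_k)).
  by rewrite !nth_oneline ltnS sigma_lt /r /= lt_ik.
exists sigma; split; last by move=> s lt_s; rewrite sigma_cmp // compareS.
apply/follows_rule_compare => i k lt_ik lt_k; rewrite sigma_cmp //.
apply: eq_compare => // s le_is lt_sk; rewrite sigma_cmp ?compareS //.
exact: leq_ltn_trans lt_sk lt_k.
Qed.

Lemma follows_rule_uniq n (sigma tau : 'S_n) :
    follows_rule sigma -> follows_rule tau ->
    (forall s, s.+1 < n -> (entry sigma s < entry sigma s.+1) = (entry tau s < entry tau s.+1)) ->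
  sigma = tau.
Proof.
move=> /follows_rule_compare rule_s /follows_rule_compare rule_t eq_asc.
have lt_eq (i k : 'I_n) : i < k -> (sigma i < sigma k) = (tau i < tau k).
  move=> lt_ik; rewrite -[LHS]ltnS -[RHS]ltnS -!nth_oneline.
  rewrite -!/(entry _ _) rule_s // rule_t //; apply: eq_compare => // s _ lt_sk.
  by apply: eq_asc; apply: leq_ltn_trans lt_sk _.
apply: perm_order_uniq => i k; case: (ltngtP i k) => [|lt_ki|/val_inj ->].
- exact: lt_eq.
- have := lt_eq k i lt_ki; have neq (rho : 'S_n) : rho i != rho k :> nat.
    by rewrite (inj_eq val_inj) (inj_eq perm_inj) -(inj_eq val_inj) /= gtn_eqF.
  by have := neq sigma; have := neq tau; lia.
- by rewrite !ltnn.
Qed.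

Lemma entry_desc n (sigma : 'S_n) s : s.+1 < n ->
  (entry sigma s.+1 < entry sigma s) = ~~ (entry sigma s < entry sigma s.+1).
Proof.
move=> lt_s; have : entry sigma s != entry sigma s.+1.
  by apply/eqP => /oneline_nth_inj; lia.
lia.
Qed.

Lemma card_follows_rule n (A : pred 'S_n) (K : pred nat) :
    (forall sigma : 'S_n, A sigma <-> follows_rule sigma /\ K #|Des sigma|) ->
  forall S, #|[pred sigma : 'S_n | A sigma & Des sigma == S]| = K #|S|.
Proof.
move=> A_rule S.
have Des_asc (sigma : 'S_n) (s : 'I_n.-1) :
    (s \in Des sigma) = ~~ (entry sigma s < entry sigma s.+1).
  by rewrite mem_Des -entry_desc //; case: s => s /=; lia.
case K_S: (K #|S|); last first.
  apply: eq_card0 => sigma; rewrite inE; apply/negP => /andP[/A_rule[_ +] /eqP eq_S].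
  by rewrite eq_S K_S.
pose a s := if insub s is Some x then (x : 'I_n.-1) \notin S else true.
have [sigma [rule asc]] := follows_rule_exists n a.
have Des_sigma : Des sigma = S.
  apply/setP => s; rewrite Des_asc asc; last by case: s => s /=; lia.
  by rewrite /a valK negbK.
apply: (@eq_card1 _ sigma) => tau; rewrite !inE; apply/andP/eqP => [[A_tau /eqP Des_tau]|->].
  have [rule_tau _] := (A_rule tau).1 A_tau.
  apply: follows_rule_uniq => // s lt_s; have lt_s' : s < n.-1 by lia.
  have := Des_asc tau (Ordinal lt_s'); have := Des_asc sigma (Ordinal lt_s').
  by rewrite Des_tau Des_sigma => -> /negb_inj.
by rewrite Des_sigma; split=> //; apply/A_rule; rewrite Des_sigma K_S.
Qed.

End PatternOrders.

(** * The sets of the list are Schur nonnegative *)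

Definition all_triples (h : rel bool) n (sigma : 'S_n) : Prop :=
  forall i j k, i < j -> j < k -> k < n ->
    h (entry sigma i < entry sigma j) (entry sigma j < entry sigma k).

(** Separates the two effects of a pattern set: [f] fixes the outer comparison of a triple, and [h]
    forbids some combinations of the inner ones altogether. *)
Definition rule_for (L : seq (seq nat)) (f h : bool -> bool -> bool) : Prop :=
  forall x y z, x != y -> x != z -> y != z ->
    (std3 x y z \notin L) = ((x < z) == f (x < y) (y < z)) && h (x < y) (y < z).

Lemma avoids_rule n (sigma : 'S_n) L f h : rule_for L f h ->
  avoids (patterns L) sigma <-> follows_rule f sigma /\ all_triples h sigma.
Proof.
move=> Lfh.
have neq i j : i < j -> j < n -> entry sigma i != entry sigma j.
  by move=> lt_ij lt_j; apply/eqP => /oneline_nth_inj; lia.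
have triple i j k : i < j -> j < k -> k < n ->
    (std3 (entry sigma i) (entry sigma j) (entry sigma k) \notin L) =
    ((entry sigma i < entry sigma k) == f (entry sigma i < entry sigma j) (entry sigma j < entry sigma k))
    && h (entry sigma i < entry sigma j) (entry sigma j < entry sigma k).
  by move=> lt_ij lt_jk lt_k; rewrite Lfh ?neq //; lia.
rewrite avoidsP; split=> [av|[rule hs] i j k lt_ij lt_jk lt_k].
  by split=> i j k lt_ij lt_jk lt_k; have := av i j k lt_ij lt_jk lt_k;
     rewrite triple // => /andP[/eqP].
by have := triple i j k lt_ij lt_jk lt_k; rewrite hs // (rule i j k) // eqxx.
Qed.

Section RuleSets.

Variable f : bool -> bool -> bool.
Hypotheses (fA : associative f) (fxx : idempotent_op f).

Lemma follows_rule_const n (sigma : 'S_n) c i k :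
    follows_rule f sigma -> i < k -> k < n ->
    (forall s, i <= s -> s < k -> (entry sigma s < entry sigma s.+1) = c) ->
  (entry sigma i < entry sigma k) = c.
Proof.
move=> /(follows_rule_compare fA) rule lt_ik lt_k all_c; rewrite rule //.
rewrite (@eq_compare f _ (fun=> c)) // /compare.
by elim: (k - i.+1) => //= d ->; rewrite fxx.
Qed.

Lemma mem_Des_entry n (sigma : 'S_n) (s : 'I_n.-1) :
  (s \in Des sigma) = ~~ (entry sigma s < entry sigma s.+1).
Proof. by rewrite mem_Des -entry_desc //; case: s => s /=; lia. Qed.

Definition step_set n (sigma : 'S_n) (b : bool) : {set 'I_n.-1} :=
  [set s : 'I_n.-1 | (entry sigma s < entry sigma s.+1) == b].

Lemma card_step_set n (sigma : 'S_n) b :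
  #|step_set sigma b| = if b then n.-1 - #|Des sigma| else #|Des sigma|.
Proof.
case: b.
  have -> : step_set sigma true = ~: Des sigma.
    by apply/setP => s; rewrite in_setC mem_Des_entry inE negbK eqb_id.
  by rewrite cardsCs setCK card_ord.
by apply: eq_card => s; rewrite mem_Des_entry inE eqbF_neg.
Qed.

Definition hooks_few n (b : bool) : pred nat :=
  fun d => (if b then n.-1 - d else d) <= 1.

(** Given two steps [s < t] of kind [b], absorption spreads one of them over the positions between,
    which yields the forbidden triple [s], [s.+1], [t.+1] or [s], [t], [t.+1]. Conversely, by
    idempotence a comparison of kind [b] needs a step of kind [b] inside its interval, so a
    forbidden triple yields two such steps. *)
Lemma all_triples_few n (sigma : 'S_n) b :
    follows_rule f sigma ->
    (forall x, f x b = b) \/ (forall x, f b x = b) ->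
  all_triples (fun p q => ~~ ((p == b) && (q == b))) sigma <->
  hooks_few n b #|Des sigma|.
Proof.
move=> rule fb; rewrite /hooks_few -card_step_set; split=> [no_mono|].
  apply/card_le1_eqP => s t; rewrite !inE.
  wlog lt_st : s t / s < t.
    move=> wl s_in t_in; case: (ltngtP s t) => [lt_st|lt_ts|/val_inj //].
      exact: wl.
    by apply/esym/wl.
  move=> /eqP s_b /eqP t_b; exfalso; have lt_t := ltn_ord t.
  have lt_tn : t.+1 < n by lia.
  case: fb => [fb|bf].
    have := no_mono s s.+1 t.+1 (ltnSn _) lt_st lt_tn; rewrite s_b eqxx /=.
    case: (eqVneq s.+1 t) => [->|ne_st]; first by rewrite t_b eqxx.
    by rewrite (rule s.+1 t t.+1) ?t_b ?fb ?eqxx //; lia.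
  have := no_mono s t t.+1 lt_st (ltnSn _) lt_tn; rewrite t_b eqxx andbT.
  case: (eqVneq s.+1 t) => [<-|ne_st]; first by rewrite s_b eqxx.
  by rewrite (rule s s.+1 t) ?s_b ?bf ?eqxx //; lia.
move=> /card_le1_eqP le1 i j k lt_ij lt_jk lt_k; apply/negP => /andP[/eqP ij_b /eqP jk_b].
have step u v : u < v -> v < n -> (entry sigma u < entry sigma v) = b ->
    exists2 s : 'I_n.-1, s \in step_set sigma b & u <= s < v.
  move=> lt_uv lt_v uv_b; case: (pickP [pred s : 'I_n.-1 | (s \in step_set sigma b) && (u <= s < v)]).
    by move=> s /andP[]; exists s.
  move=> none; have uv_nb : (entry sigma u < entry sigma v) = ~~ b.
    apply: follows_rule_const => // s le_us lt_sv; have lt_s : s < n.-1 by lia.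
    have := none (Ordinal lt_s); rewrite /= inE le_us lt_sv andbT /=.
    by case: (_ < _); case: (b).
  by move: uv_b; rewrite uv_nb; case: (b).
have lt_j := ltn_trans lt_jk lt_k.
have [s s_in /andP[_ lt_sj]] := step i j lt_ij lt_j ij_b.
have [t t_in /andP[le_jt _]] := step j k lt_jk lt_k jk_b.
by have := congr1 val (le1 s t s_in t_in) => /=; lia.
Qed.

Lemma follows_rule_Des_const n (sigma : 'S_n) c :
    follows_rule f sigma -> #|Des sigma| = (if c then 0 else n.-1) ->
  forall i k, i < k -> k < n -> (entry sigma i < entry sigma k) = c.
Proof.
move=> rule card_Des i k lt_ik lt_k; apply: follows_rule_const => // s le_is lt_sk.
have lt_s : s < n.-1 by lia.
apply: negb_inj; rewrite -(mem_Des_entry sigma (Ordinal lt_s)).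
case: c card_Des => card_Des; first by rewrite (card0_eq card_Des).
have -> : Des sigma = setT by apply/eqP; rewrite eqEcard subsetT cardsT card_ord card_Des leqnn.
by rewrite inE.
Qed.

Definition hooks_extreme n : pred nat := fun d => (d == 0) || (d == n.-1).

Lemma all_triples_extreme n (sigma : 'S_n) :
    follows_rule f sigma ->
  all_triples (fun p q => p == q) sigma <-> hooks_extreme n #|Des sigma|.
Proof.
move=> rule; rewrite /hooks_extreme; split=> [eq_steps|].
  have step s : s.+1 < n -> (entry sigma s < entry sigma s.+1) = (entry sigma 0 < entry sigma 1).
    elim: s => // s IH lt_s; rewrite -IH ?(ltnW lt_s) //.
    by have /eqP -> := eq_steps s s.+1 s.+2 (ltnSn _) (ltnSn _) lt_s.
  have Des_const (s : 'I_n.-1) : (s \in Des sigma) = ~~ (entry sigma 0 < entry sigma 1).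
    by rewrite mem_Des_entry step //; case: s => s /=; lia.
  case a0: (entry sigma 0 < entry sigma 1) in Des_const.
    by rewrite (eq_card0 Des_const) eqxx.
  by rewrite (eq_card (B := 'I_n.-1)) ?card_ord ?eqxx ?orbT.
have const c : #|Des sigma| = (if c then 0 else n.-1) ->
    all_triples (fun p q => p == q) sigma.
  move=> card_c i j k lt_ij lt_jk lt_k.
  by rewrite !(follows_rule_Des_const rule card_c) // (ltn_trans lt_jk).
by case/orP=> /eqP; [apply: (const true) | apply: (const false)].
Qed.

(** Up to length 2 there are no triples and every descent set occurs; from length 3 on, only the
    monotone permutation whose comparisons all differ from [b] is left. *)
Definition hooks_single n (b : bool) : pred nat :=
  fun d => (n <= 2) || (d == if b then n.-1 else 0).

Lemma all_triples_single n (sigma : 'S_n) b :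
    follows_rule f sigma ->
  all_triples (fun p q => (p == q) && (p != b)) sigma <-> hooks_single n b #|Des sigma|.
Proof.
move=> rule; rewrite /hooks_single; have [le_n2|lt_2n] := leqP n 2.
  by split=> // _ i j k; lia.
have Des_bnd : #|Des sigma| <= n.-1 by rewrite -[X in _ <= X]card_ord max_card.
split=> [steps|].
  have eq_steps : all_triples (fun p q => p == q) sigma.
    by move=> i j k lt_ij lt_jk lt_k; have /andP[] := steps i j k lt_ij lt_jk lt_k.
  have /andP[_ ne_b] := steps 0 1 2 isT isT lt_2n.
  have lt_0 : 0 < n.-1 by lia.
  have := mem_Des_entry sigma (Ordinal lt_0); rewrite /=.
  have /orP[/eqP card0|/eqP cardT] := (all_triples_extreme rule).1 eq_steps.
    rewrite (card0_eq card0) card0 => /esym/negbFE a0.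
    by move: ne_b; rewrite a0; case: (b).
  have -> : Des sigma = setT.
    by apply/eqP; rewrite eqEcard subsetT cardsT card_ord cardT leqnn.
  rewrite inE => /esym/negbTE a0; move: ne_b; rewrite a0.
  by case: (b) => // _; rewrite cardsT card_ord.
move=> /= /eqP card_b i j k lt_ij lt_jk lt_k.
have card_Des : #|Des sigma| = if ~~ b then 0 else n.-1 by case: (b) card_b.
have lt_j := ltn_trans lt_jk lt_k; rewrite !(follows_rule_Des_const rule card_Des) //.
by case: (b).
Qed.

End RuleSets.

Lemma schur_nonneg_rule n L f h (K : pred nat) :
    associative f -> idempotent_op f -> rule_for L f h ->
    (forall sigma : 'S_n, follows_rule f sigma -> all_triples h sigma <-> K #|Des sigma|) ->
  schur_nonneg n (Q n (patterns L)).
Proof.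
move=> fA fxx Lfh hK; apply: (@schur_nonneg_hooks _ _ _ K); apply: (card_follows_rule fA fxx).
move=> sigma; rewrite (avoids_rule _ Lfh); split=> -[rule H]; split=> //; exact/hK.
Qed.

Lemma schur_nonneg_pair n L f :
    associative f -> idempotent_op f -> rule_for L f (fun _ _ => true) ->
  schur_nonneg n (Q n (patterns L)).
Proof. by move=> fA fxx Lf; apply: (schur_nonneg_rule (K := predT) fA fxx Lf). Qed.

Lemma schur_nonneg_few n L f b :
    associative f -> idempotent_op f -> (forall x, f x b = b) \/ (forall x, f b x = b) ->
    rule_for L f (fun p q => ~~ ((p == b) && (q == b))) ->
  schur_nonneg n (Q n (patterns L)).
Proof.
move=> fA fxx fb Lf; apply: (schur_nonneg_rule fA fxx Lf) => sigma rule.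
exact: all_triples_few.
Qed.

Lemma schur_nonneg_extreme n L f :
    associative f -> idempotent_op f -> rule_for L f (fun p q => p == q) ->
  schur_nonneg n (Q n (patterns L)).
Proof.
move=> fA fxx Lf; apply: (schur_nonneg_rule fA fxx Lf) => sigma rule.
exact: all_triples_extreme.
Qed.

Lemma schur_nonneg_single n L f b :
    associative f -> idempotent_op f -> rule_for L f (fun p q => (p == q) && (p != b)) ->
  schur_nonneg n (Q n (patterns L)).
Proof.
move=> fA fxx Lf; apply: (schur_nonneg_rule fA fxx Lf) => sigma rule.
exact: all_triples_single.
Qed.

Lemma rule_for_check L f h :
    [&& (w123 \notin L) == (true == f true true) && h true true,
        (w132 \notin L) == (true == f true false) && h true false,
        (w231 \notin L) == (false == f true false) && h true false,
        (w213 \notin L) == (true == f false true) && h false true,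
        (w312 \notin L) == (false == f false true) && h false true &
        (w321 \notin L) == (false == f false false) && h false false] ->
  rule_for L f h.
Proof.
case/and5P=> /eqP e123 /eqP e132 /eqP e231 /eqP e213 /andP[/eqP e312 /eqP e321].
move=> x y z ne_xy ne_xz ne_yz; rewrite /std3.
case: (ltnP x y) => xy; case: (ltnP y z) => yz; case: (ltnP x z) => xz //;
  exfalso; move: ne_xy ne_xz ne_yz xy yz xz; clear; lia.
Qed.

(** The four sets of two patterns give, in order, conjunction, second projection, first projection
    and disjunction. In the larger sets [b] is [true] when 123 is excluded and [false] when 321 is.
    Where the inner comparisons must agree, all idempotent rules coincide and the first projection
    stands for them. *)
Lemma symmetric_pattern_sets_schur_nonneg (Pi : {set 'S_3}) n :
  Pi \in symmetric_pattern_sets -> schur_nonneg n (Q n Pi).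
Proof.
have fstA : associative (fun p _ : bool => p) by [].
have sndA : associative (fun _ q : bool => q) by [].
rewrite !inE => /orP[/eqP->|]; first exact: schur_nonneg_Q_all.
case/orP=> [/eqP->|]; first exact: schur_nonneg_Q123.
case/orP=> [/eqP->|]; first exact: schur_nonneg_Q321.
case/orP=> [/eqP->|]; first by apply: (schur_nonneg_pair _ andbA andbb); exact: rule_for_check.
case/orP=> [/eqP->|]; first by apply: (schur_nonneg_pair _ sndA); [by [] | exact: rule_for_check].
case/orP=> [/eqP->|]; first by apply: (schur_nonneg_pair _ fstA); [by [] | exact: rule_for_check].
case/orP=> [/eqP->|]; first by apply: (schur_nonneg_pair _ orbA orbb); exact: rule_for_check.
case/orP=> [/eqP->|].
  by apply: (@schur_nonneg_few _ _ _ true sndA); [by [] | by left | exact: rule_for_check].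
case/orP=> [/eqP->|].
  by apply: (@schur_nonneg_few _ _ _ true fstA); [by [] | by right | exact: rule_for_check].
case/orP=> [/eqP->|].
  by apply: (@schur_nonneg_few _ _ _ true orbA orbb); [left; apply: orbT | exact: rule_for_check].
case/orP=> [/eqP->|].
  by apply: (@schur_nonneg_few _ _ _ false andbA andbb); [left; apply: andbF | exact: rule_for_check].
case/orP=> [/eqP->|].
  by apply: (@schur_nonneg_few _ _ _ false sndA); [by [] | by left | exact: rule_for_check].
case/orP=> [/eqP->|].
  by apply: (@schur_nonneg_few _ _ _ false fstA); [by [] | by right | exact: rule_for_check].
case/orP=> [/eqP->|].
  by apply: (schur_nonneg_extreme _ fstA); [by [] | exact: rule_for_check].
case/orP=> /eqP->.
  by apply: (@schur_nonneg_single _ _ _ true fstA); [by [] | exact: rule_for_check].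
by apply: (@schur_nonneg_single _ _ _ false fstA); [by [] | exact: rule_for_check].
Qed.

(** * The other sets are not symmetric *)

Definition patterns3 : seq (seq nat) := [:: w123; w132; w213; w231; w312; w321].

Lemma patterns_of_set (Pi : {set 'S_3}) :
  Pi = patterns [seq w <- patterns3 | [exists pi in Pi, oneline pi == w]].
Proof.
apply/setP => pi; rewrite inE mem_filter.
have -> : oneline pi \in patterns3.
  by rewrite std3_oneline /std3; do !case: ifP.
rewrite andbT; apply/idP/exists_inP => [pi_in|[rho rho_in /eqP/oneline_inj <- //]].
by exists pi.
Qed.

Lemma perm_oneline n :
  perm_eq [seq oneline sigma | sigma <- enum 'S_n] (permutations (iota 1 n)).
Proof.
apply: uniq_perm; rewrite ?permutations_uniq //.
  by rewrite (map_inj_uniq (@oneline_inj n)) enum_uniq.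
move=> w; rewrite mem_permutations; apply/mapP/idP => [[sigma _ ->]|perm_w].
  have -> : oneline sigma = [seq x.+1 | x <- [seq val i | i <- [seq sigma i | i <- enum 'I_n]]].
    by rewrite -[RHS]map_comp -[RHS]map_comp.
  have -> : iota 1 n = [seq x.+1 | x <- [seq val i | i <- enum 'I_n]].
    by rewrite val_enum_ord -(iotaDl 1 0).
  do 2!apply: perm_map; apply: uniq_perm; rewrite ?enum_uniq //.
    by rewrite (map_inj_uniq perm_inj) enum_uniq.
  by move=> i; rewrite mem_enum inE; apply/mapP; exists (sigma^-1%g i); rewrite ?mem_enum ?permKV.
have sz_w : size w = n by rewrite (perm_size perm_w) size_iota.
have w_uniq : uniq w by rewrite (perm_uniq perm_w) iota_uniq.
have w_bnd i : i < n -> 0 < nth 0 w i <= n.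
  move=> lt_i; have : nth 0 w i \in w by rewrite mem_nth ?sz_w.
  by rewrite (perm_mem perm_w) mem_iota add1n ltnS.
have lt_w (i : 'I_n) : (nth 0 w i).-1 < n by have := w_bnd i (ltn_ord i); lia.
have w_inj : injective (fun i : 'I_n => Ordinal (lt_w i)).
  move=> i j [] eq_ij; have eq_w : nth 0 w i = nth 0 w j.
    by have := w_bnd i (ltn_ord i); have := w_bnd j (ltn_ord j); lia.
  by apply: val_inj; move/eqP: eq_w; rewrite nth_uniq ?sz_w // => /eqP.
exists (perm w_inj); first by rewrite mem_enum.
apply: (@eq_from_nth _ 0); rewrite ?size_oneline // sz_w => i lt_i.
rewrite -[i in RHS]/(val (Ordinal lt_i)) nth_oneline permE /= prednK //.
by case/andP: (w_bnd i lt_i).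
Qed.

(** A coefficient of [Q] restated over lists of numbers, so that it can be evaluated by computation;
    permutations as finite functions do not reduce well. *)
Definition coefficient (n : nat) (L : seq (seq nat)) (s : seq nat) : nat :=
  count (fun w =>
    all (fun i => all (fun j => all (fun k =>
      (i < j) && (j < k) ==> (std3 (nth 0 w i) (nth 0 w j) (nth 0 w k) \notin L))
      (iota 0 n)) (iota 0 n)) (iota 0 n) &&
    all (fun i => (nth 0 w i.+1 < nth 0 w i) ==> (nth 0 s i < nth 0 s i.+1))
      (iota 0 n.-1))
  (permutations (iota 1 n)).

Lemma Q_coefficient n L s : size s = n -> sorted leq s ->
  Q n (patterns L) (seq_mset s) = Posz (coefficient n L s).
Proof.
move=> sz_s s_sorted.
have perm_s : perm_eq (seq_mset s) s := perm_eq_seq_mset s.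
rewrite Q_coef (perm_size perm_s) sz_s eqxx; congr Posz.
have -> : sort leq (seq_mset s) = s.
  apply: (sorted_eq leq_trans anti_leq) => //; first exact: sort_sorted leq_total _.
  by rewrite perm_sort.
rewrite /coefficient -(seq.permP (perm_oneline n)) count_map -size_filter cardE enumT.
congr size; apply: eq_filter => sigma; rewrite !inE /=; congr andb.
  apply/idP/idP => [/avoidsP av|av]; last apply/avoidsP => i j k lt_ij lt_jk lt_k.
    apply/allP => i _; apply/allP => j _; apply/allP => k; rewrite mem_iota => /andP[_ lt_k].
    by apply/implyP => /andP[lt_ij lt_jk]; apply: av.
  have lt_j := ltn_trans lt_jk lt_k; have lt_i := ltn_trans lt_ij lt_j.
  have in_iota x : x < n -> x \in iota 0 n by rewrite mem_iota.
  have /allP/(_ j (in_iota j lt_j))/allP/(_ k (in_iota k lt_k)) := allP av i (in_iota i lt_i).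
  by rewrite lt_ij lt_jk.
apply/compatibleP/allP => [compat i|compat i lt_i desc].
  rewrite mem_iota => lt_i; apply/implyP; apply: compat; lia.
by have := compat i; rewrite mem_iota desc; apply; lia.
Qed.

(** This transposition serves both tests: it exchanges $x_0x_1^2$ with $x_0^2x_1$, and $x_0x_1^2x_2$
    with $x_0^2x_1x_2$. *)
Definition swap01 (x : nat) : nat := if x == 0 then 1 else if x == 1 then 0 else x.

Lemma swap01K : involutive swap01. Proof. by case=> [|[|x]]. Qed.

Lemma symmetric_coefficient n L s s' : symmetric_series (Q n (patterns L)) ->
    size s = n -> sorted leq s -> sorted leq s' -> perm_eq s' (map swap01 s) ->
  coefficient n L s' = coefficient n L s.
Proof.
move=> sym sz_s s_sorted s'_sorted perm_s'.
have sz_s' : size s' = n by rewrite (perm_size perm_s') size_map.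
have := sym swap01 (inv_bij swap01K) (seq_mset s).
have -> : rename swap01 (seq_mset s) = seq_mset s'.
  apply/eq_seq_msetP; apply: perm_trans (perm_map swap01 (perm_eq_seq_mset s)) _.
  by rewrite perm_sym.
by rewrite !Q_coefficient // => -[].
Qed.

Definition symmetric_pattern_lists : seq (seq (seq nat)) :=
  [:: [::];
      [:: w123];
      [:: w321];
      [:: w132; w213];
      [:: w132; w312];
      [:: w213; w231];
      [:: w231; w312];
      [:: w123; w132; w312];
      [:: w123; w213; w231];
      [:: w123; w231; w312];
      [:: w132; w213; w321];
      [:: w132; w312; w321];
      [:: w213; w231; w321];
      [:: w132; w213; w231; w312];
      [:: w123; w132; w213; w231; w312];
      [:: w132; w213; w231; w312; w321]].

Lemma symmetric_pattern_setsE :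
  symmetric_pattern_sets = [seq patterns L | L <- symmetric_pattern_lists].
Proof. by []. Qed.

(* Degree 3 leaves only {123, 132, 213} and {231, 312, 321} besides the sets
   of the list; degree 4 excludes them. *)
Definition degree_tests (L : seq (seq nat)) : bool :=
  [&& ~~ ((w123 \in L) && (w321 \in L)),
      coefficient 3 L [:: 0; 1; 1] == coefficient 3 L [:: 0; 0; 1] &
      coefficient 4 L [:: 0; 1; 1; 2] == coefficient 4 L [:: 0; 0; 1; 2]].

(** A computable quantifier over the 64 subsets of [patterns3], given as masks. Masks keep the order
    of [patterns3], which the lists in [symmetric_pattern_lists] follow too, so comparing lists
    literally compares sets. *)
Fixpoint all_bitseqs (n : nat) (P : pred bitseq) : bool :=
  if n is n'.+1 then
    all_bitseqs n' (fun b => P (true :: b)) && all_bitseqs n' (fun b => P (false :: b))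
  else P [::].

Lemma all_bitseqsP n (P : pred bitseq) b : all_bitseqs n P -> size b = n -> P b.
Proof.
elim: n P b => [|n IH] P [|c b] //= /andP[Pt Pf] [sz_b].
by case: c; [apply: (IH _ _ Pt) | apply: (IH _ _ Pf)].
Qed.

Lemma degree_tests_lists :
  all_bitseqs 6 (fun b => degree_tests (mask b patterns3) ==>
                          (mask b patterns3 \in symmetric_pattern_lists)).
Proof. by vm_compute. Qed.

Lemma symmetric_pattern_setsP (Pi : {set 'S_3}) :
    ~~ (patterns [:: w123; w321] \subset Pi) ->
    (forall n, symmetric_series (Q n Pi)) ->
  Pi \in symmetric_pattern_sets.
Proof.
rewrite [Pi]patterns_of_set filter_mask; set b := map _ _; set L := mask b _.
move=> not_both sym; rewrite symmetric_pattern_setsE; apply: map_f.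
have /implyP := all_bitseqsP degree_tests_lists (b := b) (size_map _ _); apply.
rewrite -/L /degree_tests; apply/and3P; split.
- apply: contra not_both => /andP[in123 in321]; apply/subsetP => pi; rewrite !inE.
  by case/orP => /eqP ->.
- by apply/eqP/symmetric_coefficient.
- by apply/eqP/symmetric_coefficient.
Qed.

Theorem theorem1p2 (Pi : {set 'S_3})
    (hPi : ~~ (patterns [:: w123; w321] \subset Pi)) :
  ((forall n : nat, symmetric_series (Q n Pi)) <->
   (forall n : nat, schur_nonneg n (Q n Pi))) /\
  ((forall n : nat, schur_nonneg n (Q n Pi)) <->
   Pi \in symmetric_pattern_sets).
Proof.
have nonneg_sym : (forall n, schur_nonneg n (Q n Pi)) -> forall n, symmetric_series (Q n Pi).
  by move=> nonneg n; case: (nonneg n).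
have list_nonneg : Pi \in symmetric_pattern_sets -> forall n, schur_nonneg n (Q n Pi).
  by move=> in_list n; apply: symmetric_pattern_sets_schur_nonneg.
have sym_list := symmetric_pattern_setsP hPi.
by split; split; auto.
Qed.
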